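(* Let $G$ be a connected graph on $n$ vertices. Then, for every real number $\alpha\ge 1$, $$\sum_{i=1}^n \lambda_i(L(G))^\alpha\ge \sum_{i=1}^n \lambda_i(L(P_n))^\alpha$$ and $$\sum_{i=1}^n \lambda_i(Q(G))^\alpha\ge \sum_{i=1}^n \lambda_i(Q(P_n))^\alpha.$$
   Context: All graphs are finite, simple, undirected and unweighted. For a graph $G$, $A(G)$ is the adjacency matrix, $D(G)$ the diagonal matrix of vertex degrees, $L(G)=D(G)-A(G)$ the Laplacian matrix and $Q(G)=D(G)+A(G)$ the signless Laplacian matrix; both are real symmetric and positive semidefinite. For a real symmetric matrix $M$, $\lambda_1(M)\ge\lambda_2(M)\ge\cdots$ are its eigenvalues repeated with multiplicity. $P_n$ denotes the path on $n$ vertices ($P_1$ is a single vertex). *)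

(* Defs.v *)
From HB Require Import structures.
From mathcomp Require Import all_boot all_order all_algebra.
From mathcomp Require Import polyrcf.
From mathcomp Require Import reals exp.

Set Implicit Arguments.
Unset Strict Implicit.
Unset Printing Implicit Defensive.

Import Order.TTheory GRing.Theory Num.Theory.
Local Open Scope ring_scope.

Record sgraph (n : nat) := SGraph {
  adj :> rel 'I_n;
  adj_sym : symmetric adj;
  adj_irrefl : irreflexive adj
}.

(* The graph with no vertex is not counted as connected. *)
Definition connected_graph (n : nat) (G : sgraph n) : Prop :=
  (0 < n)%N /\ forall x y : 'I_n, connect G x y.

Definition degree (n : nat) (G : sgraph n) (x : 'I_n) : nat :=
  #|[set y : 'I_n | G x y]|.

Definition path_rel (n : nat) : rel 'I_n :=
  fun x y => (x.+1 == y :> nat) || (y.+1 == x :> nat).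

Lemma path_rel_sym (n : nat) : symmetric (@path_rel n).
Proof. by move=> x y; rewrite /path_rel orbC. Qed.

Lemma path_rel_irrefl (n : nat) : irreflexive (@path_rel n).
Proof. by move=> x; rewrite /path_rel orbb gtn_eqF. Qed.

Definition path_graph (n : nat) : sgraph n :=
  SGraph (@path_rel_sym n) (@path_rel_irrefl n).

Definition adjacency_mx (R : realType) (n : nat) (G : sgraph n) : 'M[R]_n :=
  \matrix_(i, j) (G i j)%:R.

Definition degree_mx (R : realType) (n : nat) (G : sgraph n) : 'M[R]_n :=
  diag_mx (\row_i (degree G i)%:R).

Definition laplacian (R : realType) (n : nat) (G : sgraph n) : 'M[R]_n :=
  degree_mx R G - adjacency_mx R G.

Definition signless_laplacian (R : realType) (n : nat) (G : sgraph n) :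
    'M[R]_n :=
  degree_mx R G + adjacency_mx R G.

(* The real roots of the characteristic polynomial, each repeated according to
   its algebraic multiplicity, in nonincreasing order; this list has size n
   when M is symmetric. *)
Definition spectrum (R : realType) (n : nat) (M : 'M[R]_n) : seq R :=
  sort >=%R
    (flatten [seq nseq (mup x (char_poly M)) x | x <- rootsR (char_poly M)]).

(* 0-based: the i-th largest eigenvalue is [eigval M i.-1]. *)
Definition eigval (R : realType) (n : nat) (M : 'M[R]_n) (i : nat) : R :=
  nth 0 (spectrum M) i.

(* Main.v *)
Require Import Defs.
From HB Require Import structures.
From mathcomp Require Import all_boot all_order all_fingroup all_algebra.
From mathcomp Require Import spectral polyrcf complex zify ring lra.
From mathcomp Require Import reals topology normedtype derive exp trigo.

Set Implicit Arguments.
Unset Strict Implicit.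
Unset Printing Implicit Defensive.

Import Order.TTheory GRing.Theory Num.Theory.
Import numFieldNormedType.Exports.
Local Open Scope ring_scope.

(** Deleting edges lowers the Laplacian and the signless Laplacian in the Loewner
order, and the sum of [alpha]-th powers of the eigenvalues is monotone for that
order ([eigpow_sum_monotone]); so [G] may be replaced by a spanning tree. Both
matrices are treated together as [D - sigma A] with [sigma = 1] or
[sigma = -1]. The tree is then straightened into a path
([eigpow_sum_straighten]) by repeating a single move: a path shares one vertex
[r] with the rest of the graph, and its vertices are rearranged so that [r]
becomes an end. The theorem amounts to the fact that this move does not increase
the sum ([eigpow_sum_merge]).

The spectrum of a tree need not majorize that of the path: for the star on ten
vertices the sum of [max (lambda - 1) 0] is smaller than for the path. Convexity
of the power function [f] alone cannot suffice, and the proof of the move rests on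
the convexity of [x f'(x)], which for a power is a multiple of the same power.

To compare two positions of [r] on the path, let [B] be the matrix of the path
and [attach psi] that of the rest, placed along a unit vector [psi]; a vertex of
the path corresponds to a coordinate vector, but [psi] may be any combination of
eigenvectors of [B]. Then [M = B + attach psi] can be deformed by rotating [psi]
in the plane of two eigenvectors [u] and [w] of [B], with eigenvalues [a < b].
To first order, rotating towards [w] changes the sum by a positive multiple of
the entry [u^T M^(alpha-1) w]. This entry is nonnegative ([offdiag_ge0]): in
[mu^alpha / mu], where [mu] runs over the eigenvalues of [M], replace [mu^alpha]
by its chord over [a, b]. The remainder contributes with the sign of
[(mu - a) (mu - b)], which is also the sign of the product of the coordinates of
the eigenvector along [u] and [w]: both come from the same number [tau], being
[x tau / (mu - a)] and [y tau / (mu - b)] with [x] and [y] nonnegative. The chord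
contributes its slope times [u^T w = 0], and its nonpositive intercept times an
entry of the pseudo-inverse of [M], which is nonpositive by a Schur complement
inequality. Second-order errors disappear when the rotation is cut into many
small steps ([quadratic_defect_nondecreasing]).

Hence the sum grows whenever spectral weight of [psi] is moved to larger
eigenvalues of [B] ([eigpow_sum_transport]). The eigenvectors of a path are
discrete cosines, and the spectral weight of an end vertex is stochastically
dominated by that of any other vertex ([pcoef_dominance]); this last fact is the
trigonometric inequality [sin_product]. *)

(** * Power functions and their chords *)

Section PowerFunction.
Variables (R : realType) (alpha : R).
Hypothesis alpha_ge1 : 1 <= alpha.

(** Young's inequality for [t] and [1], with exponent [alpha] and its conjugate. *)
Lemma powR_bernoulli (t : R) : 0 <= t -> 1 + alpha * (t - 1) <= t `^ alpha.
Proof.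
move=> t0; have := alpha_ge1; rewrite le_eqVlt => /predU1P[<-|alpha1].
  by rewrite powRr1//; lra.
have alpha0 : 0 < alpha by lra.
have := @conjugate_powR R t 1 alpha (alpha / (alpha - 1)) t0 ler01 alpha0.
have -> : 0 < alpha / (alpha - 1) by rewrite divr_gt0 ?subr_gt0.
have -> : alpha^-1 + (alpha / (alpha - 1))^-1 = 1.
  by field; rewrite subr_eq0; lra.
rewrite powR1 mulr1 => /(_ isT erefl) le_t.
have -> : t `^ alpha = alpha * (t `^ alpha / alpha) by field; lra.
have -> : 1 + alpha * (t - 1) = alpha * (t - 1 / (alpha / (alpha - 1))).
  by field; rewrite subr_eq0; lra.
by rewrite ler_pM2l//; lra.
Qed.

(** Bernoulli's inequality at [y / x] when [0 < x]. At [x = 0] the slope is [0],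
except for [alpha = 1], where it is [1] because [0 `^ 0 = 1]. *)
Lemma powR_tangent (x y : R) : 0 <= x -> 0 <= y ->
  x `^ alpha + alpha * x `^ (alpha - 1) * (y - x) <= y `^ alpha.
Proof.
rewrite le_eqVlt => /predU1P[<-|x0] y0; last first.
  have /powR_bernoulli : 0 <= y / x by apply: divr_ge0 => //; exact: ltW.
  have -> : y `^ alpha = x `^ alpha * (y / x) `^ alpha.
    by rewrite -powRM ?divr_ge0 ?(ltW x0)// mulrC divfK ?gt_eqF.
  have -> : x `^ alpha = x * x `^ (alpha - 1).
    by rewrite mulr_powRB1 ?(ltW x0) ?(lt_le_trans ltr01 alpha_ge1).
  move=> le_b.
  have p0 : 0 <= x `^ (alpha - 1) by exact: powR_ge0.
  have := ler_wpM2l p0 (ler_wpM2l (ltW x0) le_b).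
  set q := _ `^ (alpha - 1); set r := (y / x) `^ alpha => le_qr.
  apply: le_trans (_ : q * (x * (1 + alpha * (y / x - 1))) <= _).
    by rewrite le_eqVlt; apply/orP; left; apply/eqP; field; rewrite gt_eqF.
  by apply: le_trans le_qr _; rewrite mulrA [q * x]mulrC.
have alpha_neq0 : alpha != 0 by rewrite gt_eqF ?(lt_le_trans ltr01 alpha_ge1).
rewrite powR0// add0r subr0.
have := alpha_ge1; rewrite le_eqVlt => /predU1P[<-|alpha1].
  by rewrite subrr powRr0 powRr1//; lra.
by rewrite powR0 ?mulr0 ?mul0r ?powR_ge0// subr_eq0 gt_eqF.
Qed.

Lemma powR_convex3 (x y z : R) : 0 <= x -> x <= y -> y <= z ->
  (z - x) * y `^ alpha <= (z - y) * x `^ alpha + (y - x) * z `^ alpha.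
Proof.
move=> x0 xy yz; have y0 := le_trans x0 xy; have z0 := le_trans y0 yz.
have := powR_tangent y0 x0; have := powR_tangent y0 z0.
set D := alpha * _; move: (x `^ _) (y `^ _) (z `^ _) => px py pz lez lex.
have := ler_wpM2l _ lez; have := ler_wpM2l _ lex.
move=> /(_ (z - y)) h1 /(_ (y - x)) h2.
have {}h1 := h1 (eq_ind_r is_true yz (subr_ge0 _ _)).
have {}h2 := h2 (eq_ind_r is_true xy (subr_ge0 _ _)).
apply: le_trans (lerD h1 h2).
by rewrite le_eqVlt; apply/orP; left; apply/eqP; ring.
Qed.

(** A convex function lies below its chord over [[a, b]] and above it elsewhere;
the chord meets the vertical axis below [0] because the function vanishes
there. *)
Lemma powR_chord (a b : R) : 0 <= a -> a < b ->
  exists A B : R, [/\ B <= 0, a = 0 -> B = 0,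
    a `^ alpha = A * a + B, b `^ alpha = A * b + B
    & forall x, 0 <= x ->
        0 <= (x `^ alpha - (A * x + B)) * ((x - a) * (x - b))].
Proof.
move=> a0 ab; have ba0 : 0 < b - a by rewrite subr_gt0.
have p0 : 0 `^ alpha = 0 by rewrite powR0// gt_eqF ?(lt_le_trans ltr01 alpha_ge1).
pose A := (b `^ alpha - a `^ alpha) / (b - a).
have AE : A * (b - a) = b `^ alpha - a `^ alpha by rewrite divfK// gt_eqF.
exists A, (a `^ alpha - A * a); split.
- have := powR_convex3 (lexx 0) a0 (ltW ab); rewrite p0 !subr0 mulr0 add0r => le_p.
  rewrite -(pmulr_rle0 _ ba0).
  have -> : (b - a) * (a `^ alpha - A * a) =
    (b - a) * a `^ alpha - (A * (b - a)) * a by ring.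
  by rewrite AE; move: (a `^ _) (b `^ _) le_p => pa pb; lra.
- by move=> ->; rewrite p0 mulr0 subr0.
- by ring.
- by move: AE; move: (a `^ _) (b `^ _) => pa pb; lra.
move=> x x0; rewrite -(pmulr_rge0 _ ba0).
have -> : (b - a) * ((x `^ alpha - (A * x + (a `^ alpha - A * a))) *
     ((x - a) * (x - b))) =
  ((b - a) * (x `^ alpha - a `^ alpha) - (A * (b - a)) * (x - a)) *
     ((x - a) * (x - b)) by ring.
rewrite {}AE.
have [xa|ax] := leP x a.
  have := powR_convex3 x0 xa (ltW ab) => cvx.
  by apply: mulr_ge0; [lra | apply: mulr_le0; lra].
have [xb|bx] := leP x b.
  have := powR_convex3 a0 (ltW ax) xb => cvx.
  by apply: mulr_le0; [lra | apply: mulr_ge0_le0; lra].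
have := powR_convex3 a0 (ltW ab) (ltW bx) => cvx.
by apply: mulr_ge0; [lra | apply: mulr_ge0; lra].
Qed.

End PowerFunction.

(** * Vectors and positive semidefinite matrices *)

Section Vectors.
Variables (R : realType) (n : nat).
Implicit Types (u v w : 'cV[R]_n) (M : 'M[R]_n).

Definition dot u v : R := (u^T *m v) 0 0.

Lemma dotE u v : dot u v = \sum_i u i 0 * v i 0.
Proof. by rewrite /dot mxE; apply: eq_bigr => i _; rewrite mxE. Qed.

Lemma dotC u v : dot u v = dot v u.
Proof. by rewrite !dotE; apply: eq_bigr => i _; rewrite mulrC. Qed.

Lemma dotDr u v w : dot u (v + w) = dot u v + dot u w.
Proof. by rewrite /dot mulmxDr mxE. Qed.

Lemma dotNr u v : dot u (- v) = - dot u v.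
Proof. by rewrite /dot mulmxN mxE. Qed.

Lemma dotBr u v w : dot u (v - w) = dot u v - dot u w.
Proof. by rewrite dotDr dotNr. Qed.

Lemma dotZr u a v : dot u (a *: v) = a * dot u v.
Proof. by rewrite /dot -scalemxAr mxE. Qed.

Lemma dot0r u : dot u 0 = 0.
Proof. by rewrite /dot mulmx0 mxE. Qed.

Lemma dotDl u v w : dot (v + w) u = dot v u + dot w u.
Proof. by rewrite dotC dotDr !(dotC u). Qed.

Lemma dotNl u v : dot (- v) u = - dot v u.
Proof. by rewrite dotC dotNr dotC. Qed.

Lemma dotBl u v w : dot (v - w) u = dot v u - dot w u.
Proof. by rewrite dotDl dotNl. Qed.

Lemma dotZl u a v : dot (a *: v) u = a * dot v u.
Proof. by rewrite dotC dotZr dotC. Qed.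

Lemma dot0l u : dot 0 u = 0.
Proof. by rewrite dotC dot0r. Qed.

Lemma dot_sumr u I (s : seq I) (P : pred I) (F : I -> 'cV[R]_n) :
  dot u (\sum_(i <- s | P i) F i) = \sum_(i <- s | P i) dot u (F i).
Proof. by rewrite /dot mulmx_sumr summxE. Qed.

Lemma dot_suml u I (s : seq I) (P : pred I) (F : I -> 'cV[R]_n) :
  dot (\sum_(i <- s | P i) F i) u = \sum_(i <- s | P i) dot (F i) u.
Proof. by rewrite dotC dot_sumr; apply: eq_bigr => i _; rewrite dotC. Qed.

Lemma dot_mulmxl M u v : dot (M *m u) v = dot u (M^T *m v).
Proof. by rewrite /dot trmx_mul mulmxA. Qed.

Lemma mul_outer u v w : (u *m v^T) *m w = dot v w *: u.
Proof.
rewrite -mulmxA; apply/matrixP => i j.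
by rewrite !mxE big_ord1 /dot !ord1 mulrC.
Qed.

Lemma dot_ge0 u : 0 <= dot u u.
Proof. by rewrite dotE sumr_ge0 // => i _; rewrite -expr2 sqr_ge0. Qed.

Lemma dot_eq0 u : (dot u u == 0) = (u == 0).
Proof.
rewrite dotE psumr_eq0; last by move=> i _; rewrite -expr2 sqr_ge0.
apply/allP/eqP => [u0|-> i _]; last by rewrite mxE mulr0 eqxx implybT.
apply/matrixP => i j; rewrite ord1 !mxE.
by have := u0 i (mem_index_enum i); rewrite /= mulf_eq0 orbb => /eqP.
Qed.

Lemma dot_gt0 u : (0 < dot u u) = (u != 0).
Proof. by rewrite lt_def dot_ge0 andbT dot_eq0. Qed.

Lemma cauchy_schwarz u v : dot u v ^+ 2 <= dot u u * dot v v.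
Proof.
have [->|v0] := eqVneq v 0; first by rewrite !dot0r expr0n mulr0.
have vv0 : 0 < dot v v by rewrite dot_gt0.
have := dot_ge0 (dot v v *: u - dot u v *: v).
rewrite !(dotBl, dotBr, dotZl, dotZr) (dotC v u).
move: (dot u u) (dot u v) (dot v v) vv0 => uu uv vv vv0.
have -> : vv * (vv * uu - uv * uv) - uv * (vv * uv - uv * vv) =
  vv * (uu * vv - uv ^+ 2) by ring.
by rewrite pmulr_rge0// subr_ge0.
Qed.

Definition psdmx M : Prop := M^T = M /\ forall v, 0 <= dot v (M *m v).

End Vectors.

(** * Sums of powers of eigenvalues *)

Section Spectrum.
Variable R : realType.

Lemma count_flatten_mup (p : {poly R}) x : p != 0 ->
  count_mem x (flatten [seq nseq (mup y p) y | y <- rootsR p]) = mup x p.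
Proof.
move=> p0; rewrite count_flatten -map_comp sumnE big_map.
have xroot : (x \in rootsR p) = root p x.
  by have := roots_on_rootsR p0 x; rewrite in_itv /=.
have uniqr : uniq (rootsR p) by exact: uniq_roots.
under eq_bigr => y _ do rewrite /= count_nseq /=.
have [rx|nrx] := boolP (root p x).
  rewrite (bigD1_seq x) ?xroot//= eqxx mul1n big1 ?addn0//.
  by move=> y /negPf ->; rewrite mul0n.
rewrite mupNroot// big1_seq // => y /andP[_ yr].
by case: eqVneq => [yx|]; rewrite ?mul0n//; move: nrx; rewrite -xroot -yx yr.
Qed.

Lemma spectrum_perm n (M : 'M[R]_n) (s : seq R) :
  char_poly M = \prod_(x <- s) ('X - x%:P) -> perm_eq (spectrum M) s.
Proof.
move=> Ms; rewrite /spectrum perm_sort; apply/allP => x _ /=.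
have p0 : char_poly M != 0 by rewrite monic_neq0 ?char_poly_monic.
by rewrite count_flatten_mup// Ms mu_prod_XsubC.
Qed.

Definition eigpow_sum (a : R) n (M : 'M[R]_n) : R :=
  \sum_(i < n) eigval M i `^ a.

Arguments eigpow_sum : simpl never.

Lemma eigpow_sumE (a : R) n (M : 'M[R]_n) (d : 'I_n -> R) :
  char_poly M = \prod_i ('X - (d i)%:P) ->
  eigpow_sum a M = \sum_i d i `^ a.
Proof.
move=> Md; have sM : perm_eq (spectrum M) [seq d i | i <- index_enum 'I_n].
  by apply: spectrum_perm; rewrite big_map.
have szM : size (spectrum M) = n.
  by rewrite (perm_size sM) size_map /index_enum -enumT size_enum_ord.
transitivity (\sum_(x <- spectrum M) x `^ a).
  by rewrite (big_nth 0) szM big_mkord.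
by rewrite (perm_big _ sM) big_map.
Qed.

Lemma eigpow_sum_similar (a : R) n (M U V : 'M[R]_n) : U *m V = 1%:M ->
  eigpow_sum a (U *m M *m V) = eigpow_sum a M.
Proof.
move=> UV; rewrite /eigpow_sum /eigval /spectrum.
suff -> : char_poly (U *m M *m V) = char_poly M by [].
have UVp : map_mx polyC U *m map_mx polyC V = 1%:M.
  by rewrite -map_mxM UV map_mx1.
rewrite /char_poly.
have -> : char_poly_mx (U *m M *m V) =
    map_mx polyC U *m char_poly_mx M *m map_mx polyC V.
  rewrite /char_poly_mx mulmxBr mulmxBl -!map_mxM; congr (_ - _).
  by rewrite scalar_mxC -mulmxA UVp mulmx1.
by rewrite !det_mulmx mulrAC -det_mulmx UVp det1 mul1r.
Qed.

End Spectrum.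

(** * Real frames of eigenvectors *)

Section EigenFrame.
Variables (R : realType) (n : nat).
Local Notation C := (R[i])%C.
Local Open Scope sesquilinear_scope.

(** A Parseval frame of eigenvectors: the vectors may be dependent or zero. The
resolution of the identity is all that a functional calculus needs: [f(M)] is the
sum of the [f(d_j) v_j v_j^T], and its trace is the sum of the
[f(d_j) |v_j|^2]. *)
Definition eigen_frame (J : finType) (M : 'M[R]_n) (d : J -> R)
    (v : J -> 'cV[R]_n) : Prop :=
  (forall j, M *m v j = d j *: v j) /\ \sum_j v j *m (v j)^T = 1%:M.

Lemma complex_diagonalization (M : 'M[R]_n) : M^T = M ->
  exists (U : 'M[C]_n) (r : 'I_n -> R),
  [/\ U *m U^t* = 1%:M, U^t* *m U = 1%:M,
      forall i j, \sum_k (M i k)%:C%C * U k j = (r j)%:C%C * U i j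
    & char_poly M = \prod_j ('X - (r j)%:P)].
Proof.
move=> Msym; pose A := map_mx (real_complex R) M.
have Aherm : A \is hermsymmx.
  apply/is_hermitianmxP; rewrite expr0 scale1r; apply/matrixP => i j.
  rewrite !mxE -[in RHS]Msym mxE.
  by apply/esym/CrealP/complex_realP; exists (M i j).
pose P := spectralmx A; pose sp := spectral_diag A.
have Pu : P \is unitarymx := spectral_unitarymx A.
have AE : A = invmx P *m diag_mx sp *m P.
  exact/orthomx_spectralP/hermitian_normalmx.
have spr i : exists x, sp 0 i = x%:C%C.
  apply/complex_realP.
  exact: (mxOverP (hermitian_spectral_diag_real Aherm)).
have [r rE] := fin_all_exists spr.
have PPt : P *m P^t* = 1%:M by exact/unitarymxP.
have PtP : P^t* *m P = 1%:M by exact: mulmx1C.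
rewrite invmx_unitary// in AE.
have PttE : (P^t*)^t* = P by exact: trmxCK.
exists (P^t*), r; split; rewrite ?PttE //.
- move=> i j; have : A *m P^t* = P^t* *m diag_mx sp.
    by rewrite AE -!mulmxA PPt mulmx1.
  move=> /matrixP/(_ i j).
  have -> : (A *m P^t*) i j = \sum_k (M i k)%:C%C * P^t* k j.
    by rewrite mxE; apply: eq_bigr => k _; rewrite [A i k]mxE.
  by move=> ->; rewrite mul_mx_diag mxE rE mulrC.
apply: (@map_poly_inj _ _ (real_complex R)).
rewrite map_char_poly -/A /char_poly.
have -> : char_poly_mx A =
   map_mx polyC (P^t*) *m char_poly_mx (diag_mx sp) *m map_mx polyC P.
  rewrite AE /char_poly_mx mulmxBr mulmxBl -!map_mxM; congr (_ - _).
  by rewrite scalar_mxC -mulmxA -map_mxM PtP map_mx1 mulmx1.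
rewrite !det_mulmx mulrAC -det_mulmx -map_mxM PtP map_mx1 det1 mul1r.
have trig : is_trig_mx (diag_mx sp) by exact: diag_mx_is_trig.
have := char_poly_trig trig; rewrite /char_poly => ->.
rewrite rmorph_prod; apply: eq_bigr => i _.
by rewrite rmorphB /= map_polyX map_polyC /= mxE eqxx mulr1n rE.
Qed.

(** The real and the imaginary part of each column of a diagonalizing unitary
matrix are again eigenvectors, since the eigenvalues are real, and the squared
norms of the two parts add up to 1. *)
Lemma spectral_frame (a : R) (M : 'M[R]_n) : psdmx M ->
  exists (J : finType) (d : J -> R) (v : J -> 'cV[R]_n),
  [/\ eigen_frame M d v, forall j, 0 <= d j
    & eigpow_sum a M = \sum_j d j `^ a * dot (v j) (v j)].
Proof.
move=> [Msym Mpos]; have [U [r [UUt UtU MU Mr]]] := complex_diagonalization Msym.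
pose part (b : bool) (z : C) : R := if b then complex.Re z else complex.Im z.
pose v (p : 'I_n * bool) : 'cV[R]_n := \col_i part p.2 (U i p.1).
have partD b : {morph part b : x y / x + y} by case: b => -[? ?] [? ?].
have part0 b : part b 0 = 0 by case: b.
have partZ b (x : R) (z : C) : part b (x%:C%C * z) = x * part b z.
  by case: b z => -[y z] /=; rewrite mul0r ?subr0 ?addr0.
have ReE (x y : C) : complex.Re (x * y^*%R) =
    part true x * part true y + part false x * part false y.
  by case: x y => [x1 x2] [y1 y2] /=; rewrite mulrN opprK.
have vE p : M *m v p = r p.1 *: v p.
  apply/matrixP => i k; rewrite ord1 !mxE.
  have /(congr1 (part p.2)) := MU i p.1.
  rewrite (big_morph _ (partD p.2) (part0 p.2)) partZ => <-.
  by apply: eq_bigr => l _; rewrite partZ mxE.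
have vN j : dot (v (j, true)) (v (j, true)) + dot (v (j, false)) (v (j, false)) = 1.
  have /matrixP/(_ j j) := UtU; rewrite !mxE eqxx => /(congr1 (part true)).
  rewrite (big_morph _ (partD true) (part0 true)) => /= <-.
  rewrite !dotE -big_split; apply: eq_bigr => i _.
  by rewrite !mxE /= [in RHS]mulrC ReE.
exists ('I_n * bool)%type, (fun p => r p.1), v; split; [split=> [p|] | | ].
- exact: vE.
- apply/matrixP => i k; rewrite summxE.
  rewrite -(pair_bigA _ (fun j b => (v (j, b) *m (v (j, b))^T) i k)) /=.
  have /matrixP/(_ i k)/(congr1 (part true)) := UUt.
  rewrite !mxE (big_morph _ (partD true) (part0 true)) /=.
  have -> : complex.Re ((i == k)%:R : C) = (i == k)%:R by case: (i == k).
  move=> <-; apply: eq_bigr => j _; rewrite big_bool /= !mxE !big_ord1 !mxE.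
  by rewrite ReE.
- move=> [j b] /=; rewrite -[r j]mulr1 -(vN j) mulrDr.
  have h p := Mpos (v p).
  by rewrite addr_ge0 //; [have := h (j, true) | have := h (j, false)];
    rewrite vE dotZr.
rewrite (eigpow_sumE _ Mr).
rewrite -(pair_bigA _ (fun j b => r j `^ a * dot (v (j, b)) (v (j, b)))) /=.
by apply: eq_bigr => j _; rewrite big_bool /= -mulrDr vN mulr1.
Qed.

Lemma frame_parseval (J : finType) M (d : J -> R) (v : J -> 'cV[R]_n) x y :
  eigen_frame M d v -> dot x y = \sum_j dot x (v j) * dot y (v j).
Proof.
move=> [_ v1]; rewrite -[y in LHS]mul1mx -v1 mulmx_suml dot_sumr.
by apply: eq_bigr => j _; rewrite mul_outer dotZr mulrC (dotC y).
Qed.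

End EigenFrame.

(** * Tangent inequality for the sum of powers *)

Section Tangent.
Variables (R : realType) (alpha : R) (n : nat).
Hypothesis alpha_ge1 : 1 <= alpha.
Implicit Types (M N : 'M[R]_n).

(** The squared inner products of the vectors of two frames serve as joint weights
of the pairs of eigenvalues of [M] and [N], and the tangent inequality holds for
each pair. *)
Lemma eigpow_sum_tangent M N (J : finType) (d : J -> R) (v : J -> 'cV[R]_n) :
  psdmx M -> psdmx N -> eigen_frame M d v -> (forall j, 0 <= d j) ->
  eigpow_sum alpha M = \sum_j d j `^ alpha * dot (v j) (v j) ->
  eigpow_sum alpha M
    + \sum_j alpha * d j `^ (alpha - 1) * dot (v j) ((N - M) *m v j)
  <= eigpow_sum alpha N.
Proof.
move=> Mpsd Npsd vF d0 ->.
have [I [e [w [wF e0 ->]]]] := spectral_frame alpha Npsd.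
have -> : \sum_i e i `^ alpha * dot (w i) (w i) =
    \sum_j \sum_i e i `^ alpha * dot (v j) (w i) ^+ 2.
  rewrite exchange_big; apply: eq_bigr => i _.
  rewrite (frame_parseval _ _ vF) mulr_sumr; apply: eq_bigr => j _.
  by rewrite -expr2 dotC.
rewrite -big_split; apply: ler_sum => j _ /=.
have -> : dot (v j) ((N - M) *m v j) =
    \sum_i (e i - d j) * dot (v j) (w i) ^+ 2.
  rewrite mulmxBl dotBr (proj1 vF j) dotZr.
  rewrite !(frame_parseval _ _ wF) mulr_sumr -sumrB; apply: eq_bigr => i _.
  rewrite dot_mulmxl (proj1 Npsd) (proj1 wF i) dotZr; ring.
rewrite (frame_parseval _ _ wF) !mulr_sumr -big_split; apply: ler_sum => i _ /=.
have -> : d j `^ alpha * (dot (v j) (w i) * dot (v j) (w i)) +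
   alpha * d j `^ (alpha - 1) * ((e i - d j) * dot (v j) (w i) ^+ 2) =
   (d j `^ alpha + alpha * d j `^ (alpha - 1) * (e i - d j))
     * dot (v j) (w i) ^+ 2 by ring.
by apply: ler_wpM2r; [exact: sqr_ge0 | exact: powR_tangent].
Qed.

Lemma eigpow_sum_monotone M N : psdmx M -> psdmx N ->
  (forall v, dot v (M *m v) <= dot v (N *m v)) ->
  eigpow_sum alpha M <= eigpow_sum alpha N.
Proof.
move=> Mpsd Npsd MN; have [J [d [v [vF d0 ME]]]] := spectral_frame alpha Mpsd.
apply: le_trans (eigpow_sum_tangent Mpsd Npsd vF d0 ME).
rewrite lerDl sumr_ge0 // => j _; rewrite mulr_ge0//.
  by rewrite mulr_ge0 ?powR_ge0 ?(le_trans ler01).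
by rewrite mulmxBl dotBr subr_ge0.
Qed.

End Tangent.

(** * Attaching a matrix to another along a vector *)

Section Glue.
Variables (R : realType) (n : nat).

(** The quadratic form of the bordered matrix with blocks [H0], [g], [g^T], [h] is
nonnegative. The last coordinate [t] stands for the vertex shared with the path,
the others for the rest of the graph. *)
Definition bordered_ge0 (H0 : 'M[R]_n) (g : 'cV[R]_n) (h : R) : Prop :=
  forall z t, 0 <= dot z (H0 *m z) + 2 * t * dot g z + h * t ^+ 2.

Variable alpha : R.
Hypothesis alpha_ge1 : 1 <= alpha.
Variables (B H0 : 'M[R]_n) (g : 'cV[R]_n) (h : R).
Hypothesis B_psd : psdmx B.
Hypothesis H0_sym : H0^T = H0.
Hypothesis H_ge0 : bordered_ge0 H0 g h.

(** The bordered matrix with its last coordinate placed along [psi]. Letting [psi]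
range over all vectors interpolates between the vertices of the path. *)
Definition attach (psi : 'cV[R]_n) : 'M[R]_n :=
  H0 + g *m psi^T + psi *m g^T + h *: (psi *m psi^T).

Definition glued (psi : 'cV[R]_n) : 'M[R]_n := B + attach psi.

Lemma attach_mulE psi z : attach psi *m z =
  H0 *m z + dot psi z *: g + dot g z *: psi + (h * dot psi z) *: psi.
Proof. by rewrite /attach !mulmxDl -scalemxAl !mul_outer scalerA. Qed.

Lemma bordered_corner_ge0 : 0 <= h.
Proof.
have := H_ge0 0 1; rewrite mulmx0 !dot0r mulr0 !add0r expr1n mulr1; exact.
Qed.

Lemma glued_psd psi : psdmx (glued psi).
Proof.
split.
  rewrite /glued /attach !linearD /= linearZ /= !trmx_mul !trmxK.
  by rewrite (proj1 B_psd) H0_sym; congr (_ + (_ + _)); rewrite addrAC.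
move=> z; rewrite /glued mulmxDl dotDr addr_ge0 ?(proj2 B_psd)//.
rewrite attach_mulE !dotDr !dotZr.
have := H_ge0 z (dot psi z); rewrite (dotC z g) (dotC z psi) => le_q.
apply: le_trans le_q _.
by rewrite le_eqVlt; apply/orP; left; apply/eqP; ring.
Qed.

(** An isometry that fixes the attached part acts on the attaching vector only. *)
Lemma attach_conj (P : 'M[R]_n) psi : P^T *m P = 1%:M ->
  H0 *m P = H0 -> P^T *m g = g ->
  P^T *m attach (P *m psi) *m P = attach psi.
Proof.
move=> PtP H0P Pg.
have PH0 : P^T *m H0 = H0 by apply: trmx_inj; rewrite trmx_mul trmxK H0_sym H0P.
have gP : g^T *m P = g^T by apply: trmx_inj; rewrite trmx_mul !trmxK Pg.
have psiP : (P *m psi)^T *m P = psi^T by rewrite trmx_mul -mulmxA PtP mulmx1.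
have Ppsi : P^T *m (P *m psi) = psi by rewrite mulmxA PtP mul1mx.
rewrite /attach; move: (P *m psi) psiP Ppsi => psi' psiP Ppsi.
rewrite !mulmxDr !mulmxDl -!scalemxAr -!scalemxAl.
by rewrite PH0 H0P !mulmxA Pg Ppsi -!mulmxA gP psiP.
Qed.

Section OffDiagonal.
Variables (psi u w : 'cV[R]_n) (a b : R).
Hypotheses (a_ge0 : 0 <= a) (ab : a < b).
Hypotheses (Bu : B *m u = a *: u) (Bw : B *m w = b *: w) (uw : dot u w = 0).
Hypotheses (H0u : H0 *m u = 0) (H0w : H0 *m w = 0).
Hypotheses (gu : dot g u = 0) (gw : dot g w = 0).
Hypotheses (x_ge0 : 0 <= dot psi u) (y_ge0 : 0 <= dot psi w).
Variables (J : finType) (d : J -> R) (v : J -> 'cV[R]_n).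
Hypotheses (vF : eigen_frame (glued psi) d v) (d_ge0 : forall j, 0 <= d j).

(** On a vector [z] orthogonal to the attached part, [attach psi] acts as
   [dot psi z *: c]. *)
Let c := g + h *: psi.
Let x := dot psi u.
Let y := dot psi w.
Let tau j := dot c (v j).

Let cE z : dot c z = dot g z + h * dot psi z.
Proof. by rewrite /c dotDl dotZl. Qed.

(** The eigenvector equation for [v j], paired with an eigenvector [z] of [B]. *)
Let tauE j z a' : B *m z = a' *: z -> H0 *m z = 0 -> dot g z = 0 ->
  (d j - a') * dot z (v j) = dot psi z * tau j.
Proof.
move=> Bz H0z gz.
have : dot z (glued psi *m v j) = d j * dot z (v j).
  by rewrite (proj1 vF) dotZr.
rewrite -(proj1 (glued_psd psi)) -dot_mulmxl /glued mulmxDl Bz attach_mulE H0z gz.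
rewrite !dotDl !dotZl dot0l /tau cE => E.
by rewrite mulrBl -E; ring.
Qed.

(** On the kernel of the glued matrix the attached form vanishes; being
nonnegative, it has derivative [2 tau] equal to zero there in the direction of
its last coordinate. *)
Let tau_eq0 j : d j = 0 -> tau j = 0.
Proof.
move=> dj0; have vv0 : dot (v j) (glued psi *m v j) = 0.
  by rewrite (proj1 vF) dj0 scale0r dot0r.
have {}vv0 : dot (v j) (attach psi *m v j) <= 0.
  have := proj2 B_psd (v j); move: vv0.
  by rewrite /glued mulmxDl dotDr; lra.
rewrite attach_mulE !dotDr !dotZr (dotC _ g) (dotC _ psi) in vv0.
have := bordered_corner_ge0; set k := h => k0.
(* The step [tau / (h + 1)] is small enough for the linear term to win. *)
have := H_ge0 (v j) (dot psi (v j) - tau j / (k + 1)).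
rewrite -/k in vv0 *; have := cE (v j); rewrite -/(tau j) -/k.
move: (dot (v j) _) (dot g _) (dot psi _) (tau j) vv0 => q gv pv t le0 tE.
set s := t / (k + 1); have ts : t = s * (k + 1) by rewrite divfK// gt_eqF; lra.
have -> : q + 2 * (pv - s) * gv + k * (pv - s) ^+ 2 =
   (q + pv * gv + gv * pv + k * pv * pv) - 2 * s * (gv + k * pv) + k * s ^+ 2.
  by ring.
rewrite -tE => ge0.
have {}ge0 : 0 <= - ((k + 2) * s ^+ 2).
  apply: le_trans ge0 _; rewrite ts.
  apply: le_trans (_ : 0 - 2 * s * (s * (k + 1)) + k * s ^+ 2 <= _).
    by rewrite !lerD2r.
  by rewrite le_eqVlt; apply/orP; left; apply/eqP; ring.
rewrite ts; suff -> : s = 0 by rewrite mul0r.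
apply/eqP; rewrite -sqrf_eq0 eq_le sqr_ge0 andbT.
have k2 : 0 < k + 2 by lra.
by rewrite -(pmulr_rle0 _ k2) -oppr_ge0.
Qed.

Let uw_eq0 j : d j = 0 -> dot u (v j) * dot w (v j) = 0.
Proof.
move=> dj0; have := tauE j Bw H0w gw; rewrite (tau_eq0 dj0) mulr0 dj0 sub0r.
move/eqP; rewrite mulf_eq0 oppr_eq0 gt_eqF ?(le_lt_trans a_ge0)//=.
by move=> /eqP ->; rewrite mulr0.
Qed.

(** The Schur complement inequality [c^T M^+ c <= h] for the glued matrix [M]. With
[z = M^+ c], the bordered form at [z] and [psi^T z - 1] is at most
[h - c^T M^+ c]. The convention [x / 0 = 0] makes the sum run over the nonzero
eigenvalues. *)
Let schur : \sum_j tau j ^+ 2 / d j <= h.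
Proof.
set q := \sum_j _.
pose z := \sum_j (tau j / d j) *: v j.
have cz : dot c z = q.
  by rewrite dot_sumr; apply: eq_bigr => j _; rewrite dotZr -/(tau j); ring.
have Mz : glued psi *m z = c.
  rewrite -[c]mul1mx -(proj2 vF) mulmx_suml mulmx_sumr.
  apply: eq_bigr => j _; rewrite -scalemxAr (proj1 vF) scalerA mul_outer.
  rewrite [dot (v j) c]dotC -/(tau j); have [dj0|dj0] := eqVneq (d j) 0.
    by rewrite (tau_eq0 dj0) mul0r mul0r scale0r.
  by rewrite divfK.
have : dot z (attach psi *m z) <= q.
  rewrite -cz (dotC c) -Mz /glued [(B + _) *m z]mulmxDl dotDr lerDr.
  exact: (proj2 B_psd).
rewrite attach_mulE !dotDr !dotZr (dotC _ g) (dotC _ psi).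
have := H_ge0 z (dot psi z - 1); have := cE z; rewrite cz.
move: (dot z _) (dot g _) (dot psi _) => zz gz pz -> pos neg.
have : zz + 2 * (pz - 1) * gz + h * (pz - 1) ^+ 2 =
   (zz + pz * gz + gz * pz + h * pz * pz) - 2 * (gz + h * pz) + h by ring.
by move: pos neg; lra.
Qed.

(** The sum is the entry [u^T M^(alpha-1) w]. With the chord [A mu + C] of
[mu^alpha] over [[a, b]], it exceeds [A u^T w + C S], where [u^T w = 0] and [S]
is the entry of the pseudo-inverse of [M], by a sum of nonnegative terms. Both
[C] and [S] are nonpositive, unless [a = 0], and then [C = 0]. *)
Lemma offdiag_ge0 :
  0 <= \sum_j d j `^ (alpha - 1) * (dot u (v j) * dot w (v j)).
Proof.
have alpha_gt0 : 0 < alpha by rewrite (lt_le_trans ltr01).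
have [A [C [C_le0 aC chord_a chord_b chord]]] := powR_chord alpha_ge1 a_ge0 ab.
have xy_ge0 : 0 <= x * y by rewrite mulr_ge0.
pose S := \sum_j dot u (v j) * dot w (v j) / d j.
(* Up to the factor [a b], this is [x y (c^T M^+ c - h)]. *)
have S_le0 : 0 < a -> S <= 0.
  move=> a0; have b0 := lt_trans a0 ab.
  rewrite -(pmulr_rle0 _ (mulr_gt0 a0 b0)).
  have -> : a * b * S = \sum_j d j * (dot u (v j) * dot w (v j))
     - y * (\sum_j tau j * dot u (v j)) - x * (\sum_j tau j * dot w (v j))
     + x * y * \sum_j tau j ^+ 2 / d j.
    rewrite /S !mulr_sumr -!sumrB -big_split; apply: eq_bigr => j _ /=.
    have [dj0|dj0] := eqVneq (d j) 0.
      by rewrite (tau_eq0 dj0) (uw_eq0 dj0) dj0; ring.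
    apply: (mulfI dj0).
    have := tauE j Bu H0u gu; have := tauE j Bw H0w gw; rewrite -/x -/y.
    move: (dot u _) (dot w _) (tau j) => p q t Eq Ep.
    have Ep' : a * p = d j * p - x * t by rewrite -Ep; ring.
    have Eq' : b * q = d j * q - y * t by rewrite -Eq; ring.
    transitivity ((a * p) * (b * q)); first by field.
    by rewrite Ep' Eq'; field.
  have tauz z : \sum_j tau j * dot z (v j) = dot c z.
    by rewrite (frame_parseval _ _ vF).
  have -> : \sum_j d j * (dot u (v j) * dot w (v j)) = dot u (glued psi *m w).
    rewrite (frame_parseval _ _ vF); apply: eq_bigr => j _.
    by rewrite dot_mulmxl (proj1 (glued_psd psi)) (proj1 vF) dotZr; ring.
  rewrite !tauz !cE gu gw /glued mulmxDl Bw attach_mulE H0w gw.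
  rewrite !dotDr !dotZr uw dot0r (dotC u g) gu (dotC u psi) -/x -/y.
  have := ler_wpM2l xy_ge0 schur; set q := \sum_j _ => le_q.
  have -> : b * 0 + (0 + y * 0 + 0 * x + h * y * x) - y * (0 + h * x) -
    x * (0 + h * y) + x * y * q = x * y * q - x * y * h by ring.
  by rewrite subr_le0.
have CS : 0 <= C * S.
  move: a_ge0; rewrite le_eqVlt => /predU1P[/esym/aC ->|a0].
    by rewrite mul0r.
  exact: mulr_le0 C_le0 (S_le0 a0).
have uw0 : \sum_j dot u (v j) * dot w (v j) = 0.
  by rewrite -(frame_parseval _ _ vF).
rewrite -[X in X <= _](mulr0 A) -[in X in X <= _]uw0.
rewrite -subr_ge0; apply: le_trans CS _.
rewrite /S !mulr_sumr -sumrB; apply: ler_sum => j _.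
have [dj0|dj0] := eqVneq (d j) 0; first by rewrite (uw_eq0 dj0); lra.
have dj_gt0 : 0 < d j by rewrite lt_def dj0 d_ge0.
rewrite -(ler_pM2l dj_gt0).
have -> : d j * (C * (dot u (v j) * dot w (v j) / d j)) =
  C * (dot u (v j) * dot w (v j)) by field.
have powE := mulr_powRB1 (d_ge0 j) alpha_gt0.
have -> : d j * (d j `^ (alpha - 1) * (dot u (v j) * dot w (v j)) -
    A * (dot u (v j) * dot w (v j))) =
  (d j * d j `^ (alpha - 1) - A * d j) * (dot u (v j) * dot w (v j)) by ring.
rewrite powE -subr_ge0 -mulrBl.
have -> : d j `^ alpha - A * d j - C = d j `^ alpha - (A * d j + C) by ring.
have := chord _ (d_ge0 j); set r := _ - (_ + _) => chordj.
set da := d j - a in chordj; set db := d j - b in chordj.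
have Eu : da * dot u (v j) = x * tau j by exact: tauE.
have Ew : db * dot w (v j) = y * tau j by exact: tauE.
have [dadb0|dadb0] := eqVneq (da * db) 0.
  suff -> : r = 0 by rewrite mul0r.
  move/eqP: dadb0; rewrite mulf_eq0 /da /db !subr_eq0 /r.
  by case/orP => /eqP ->; rewrite ?chord_a ?chord_b subrr.
(* The factors [da * dot u (v j)] and [db * dot w (v j)] are multiples of [tau j]
   by nonnegative numbers, so the product of the two coordinates has the sign of
   [da * db], which is that of [r]. *)
have dadb2_gt0 : 0 < (da * db) ^+ 2 by rewrite exprn_even_gt0.
rewrite -(pmulr_rge0 _ dadb2_gt0).
have -> : (da * db) ^+ 2 * (r * (dot u (v j) * dot w (v j))) =
   (r * (da * db)) * ((da * dot u (v j)) * (db * dot w (v j))) by ring.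
rewrite Eu Ew; apply: mulr_ge0 => //.
have -> : x * tau j * (y * tau j) = x * y * tau j ^+ 2 by ring.
by rewrite mulr_ge0 ?sqr_ge0.
Qed.

End OffDiagonal.
End Glue.

(** * Small steps and polar coordinates *)

Section Analysis.
Variable R : realType.

Lemma sin_mvt (x : R) : 0 <= x -> exists z, sin x = cos z * x.
Proof.
move=> x0; have [|z _] := @MVT_segment R sin cos 0 x x0.
  by apply: continuous_subspaceT => z; exact: continuous_sin.
by rewrite sin0 !subr0; exists z.
Qed.

Lemma sqr_sin_le (x : R) : 0 <= x -> sin x ^+ 2 <= x ^+ 2.
Proof.
move=> /sin_mvt[z ->]; rewrite exprMn ler_piMl ?sqr_ge0//.
by rewrite cos2sin2 lerBlDr lerDl sqr_ge0.
Qed.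

(** Over [N] equal steps the total decrease is at most [C (b - a)^2 / N]. *)
Lemma quadratic_defect_nondecreasing (F : R -> R) (a b C : R) :
  0 <= C -> a <= b ->
  (forall s t, a <= s -> 0 <= t -> s + t <= b -> F s <= F (s + t) + C * t ^+ 2) ->
  F a <= F b.
Proof.
move=> C0 ab step; rewrite leNgt; apply/negP => Fba.
set e := F a - F b; have e0 : 0 < e by rewrite subr_gt0.
pose D := C * (b - a) ^+ 2.
have D0 : 0 <= D by rewrite mulr_ge0 ?sqr_ge0.
have [N DN] : exists N, D < e * N.+1%:R.
  exists (Num.bound (D / e)); rewrite mulrC -ltr_pdivrMr//.
  apply: lt_le_trans (archi_boundP _) _; first by rewrite divr_ge0// ltW.
  by rewrite ler_nat.
pose t := (b - a) / N.+1%:R.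
have N0 : 0 < N.+1%:R :> R by rewrite ltr0n.
have t0 : 0 <= t by rewrite divr_ge0 ?subr_ge0// ltW.
have bE : b = a + N.+1%:R * t by rewrite /t mulrC divfK ?gt_eqF// addrC subrK.
have iter i : (i <= N.+1)%N -> F a <= F (a + i%:R * t) + i%:R * (C * t ^+ 2).
  elim: i => [|i IH] iN; first by rewrite !mul0r !addr0.
  apply: le_trans (IH (ltnW iN)) _.
  have := step (a + i%:R * t) t; rewrite lerDl mulr_ge0 ?ler0n// => /(_ isT t0).
  have -> : a + i%:R * t + t = a + i.+1%:R * t by rewrite -natr1; ring.
  have -> : a + i.+1%:R * t <= b.
    by rewrite bE lerD2l ler_wpM2r// ler_nat.
  by move=> /(_ isT); rewrite -natr1; lra.
have := iter _ (leqnn _); rewrite -bE => le_ab.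
have : e <= N.+1%:R * (C * t ^+ 2) by rewrite /e lerBlDl.
have -> : N.+1%:R * (C * t ^+ 2) = D / N.+1%:R.
  rewrite /t /D; move: (N.+1%:R) N0 => K K0; field.
  by rewrite gt_eqF.
by rewrite ler_pdivlMr// leNgt DN.
Qed.

Lemma polar_quadrant (x y x' y' : R) :
  0 <= x -> 0 <= y -> 0 <= x' -> y <= y' -> x ^+ 2 + y ^+ 2 = x' ^+ 2 + y' ^+ 2 ->
  exists r t t' : R, [/\ 0 <= r, 0 <= t, t <= t', t' <= pi / 2
    & [/\ x = r * cos t, y = r * sin t, x' = r * cos t' & y' = r * sin t']].
Proof.
move=> x0 y0 x'0 yy' E; have y'0 := le_trans y0 yy'.
pose r := Num.sqrt (x ^+ 2 + y ^+ 2).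
have q0 : 0 <= x ^+ 2 + y ^+ 2 by rewrite addr_ge0 ?sqr_ge0.
have r2 : r ^+ 2 = x ^+ 2 + y ^+ 2 by rewrite sqr_sqrtr.
have r0 : 0 <= r by exact: sqrtr_ge0.
have [r_eq0|r_neq0] := eqVneq r 0.
  move: r2; rewrite r_eq0 expr0n /= => /esym/eqP.
  move=> q_eq0; move: (q_eq0); rewrite E.
  move: q_eq0; rewrite !paddr_eq0 ?sqr_ge0// !sqrf_eq0.
  move=> /andP[/eqP -> /eqP ->] /andP[/eqP -> /eqP ->].
  exists 0, 0, 0; split; rewrite ?divr_ge0 ?pi_ge0//.
  by split; rewrite mul0r.
have r_gt0 : 0 < r by rewrite lt_def r_neq0.
have polar (p q : R) : 0 <= p -> 0 <= q -> p ^+ 2 + q ^+ 2 = r ^+ 2 ->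
   let t := acos (p / r) in
   [/\ 0 <= t <= pi, t <= pi / 2, p = r * cos t & q = r * sin t].
  move=> p0 q0' pq t.
  have pr0 : 0 <= p / r by rewrite divr_ge0.
  have pr1 : p / r <= 1.
    rewrite ler_pdivrMr// mul1r -(ler_pXn2r (ltn0Sn 1)) ?nnegrE//.
    by rewrite -pq lerDl sqr_ge0.
  have prI : -1 <= p / r <= 1 by rewrite pr1 andbT (le_trans _ pr0)// lerN10.
  have ct : cos t = p / r by rewrite /t acosK// in_itv.
  have tI : 0 <= t <= pi by rewrite acos_ge0 ?acos_lepi.
  split=> //.
  - rewrite leNgt; apply/negP => tpi.
    have := ltr_cos (x := pi / 2) (y := t); rewrite !in_itv /= tI.
    rewrite divr_ge0 ?pi_ge0//= ler_pdivrMr// ler_peMr ?pi_ge0 ?ler1n//.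
    by move=> /(_ isT isT); rewrite tpi cos_pihalf ct ltNge pr0.
  - by rewrite ct mulrC divfK.
  rewrite /t sin_acos// -{1}[q]ger0_norm// -sqrtr_sqr.
  rewrite -{1}[r]ger0_norm// -sqrtr_sqr -sqrtrM ?sqr_ge0//; congr Num.sqrt.
  by rewrite mulrBr mulr1 expr_div_n mulrC divfK ?expf_neq0// -pq; ring.
have [tI tpi xE yE] := polar x y x0 y0 (esym r2).
have [t'I t'pi x'E y'E] := polar x' y' x'0 y'0 (etrans (esym E) (esym r2)).
exists r, (acos (x / r)), (acos (x' / r)); split=> //; first by case/andP: tI.
rewrite leNgt; apply/negP => lt_t.
have := ltr_cos (x := acos (x' / r)) (y := acos (x / r)).
rewrite !in_itv /= tI t'I => /(_ isT isT); rewrite lt_t => lt_c.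
have : x < x' by rewrite xE x'E ltr_pM2l.
rewrite -(ltr_pXn2r (ltn0Sn 1)) ?nnegrE//.
have : y ^+ 2 <= y' ^+ 2 by rewrite ler_pXn2r ?nnegrE.
by move: E; move: (x ^+ 2) (y ^+ 2) (x' ^+ 2) (y' ^+ 2) => *; lra.
Qed.

End Analysis.

(** * Rotating the attaching vector *)

Section FrameTrace.
Variables (R : realType) (n : nat) (M : 'M[R]_n).
Variables (J : finType) (d : J -> R) (v : J -> 'cV[R]_n).
Hypotheses (M_sym : M^T = M) (vF : eigen_frame M d v) (d_ge0 : forall j, 0 <= d j).

Lemma mxtrace_outer (x : 'cV[R]_n) : \tr (x *m x^T) = dot x x.
Proof. by rewrite mxtrace_mulC /dot /mxtrace big_ord1. Qed.

Lemma frame_trace : \tr M = \sum_j d j * dot (v j) (v j).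
Proof.
rewrite -[M]mulmx1 -(proj2 vF) mulmx_sumr raddf_sum; apply: eq_bigr => j _ /=.
by rewrite mulmxA (proj1 vF) -scalemxAl mxtraceZ mxtrace_outer.
Qed.

Lemma frame_eigenvalue_le_trace j : v j != 0 -> d j <= \tr M.
Proof.
move=> vj0; have vv0 : 0 < dot (v j) (v j) by rewrite dot_gt0.
rewrite -(ler_pM2r vv0) frame_trace.
have -> : d j * dot (v j) (v j) = \sum_i d i * dot (v j) (v i) ^+ 2.
  rewrite -dotZr -(proj1 vF) (frame_parseval _ _ vF); apply: eq_bigr => i _.
  by rewrite dot_mulmxl M_sym (proj1 vF) dotZr; ring.
rewrite mulr_suml; apply: ler_sum => i _; rewrite -mulrA ler_wpM2l//.
by rewrite mulrC cauchy_schwarz.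
Qed.

(** The trace stays constant along a rotation of the attaching vector, so this
bound on the diagonal entries of [M^beta] is uniform. *)
Lemma frame_eigenvalue_weight_le (beta : R) (z : 'cV[R]_n) : 0 <= beta ->
  \sum_j d j `^ beta * dot z (v j) ^+ 2 <= (\tr M) `^ beta * dot z z.
Proof.
move=> beta0; rewrite (frame_parseval _ _ vF) mulr_sumr.
apply: ler_sum => j _; rewrite -expr2.
have [->|vj0] := eqVneq (v j) 0; first by rewrite dot0r expr0n /= !mulr0.
apply: ler_wpM2r; first exact: sqr_ge0.
have le_tr := frame_eigenvalue_le_trace vj0.
by apply: ge0_ler_powR; rewrite ?nnegrE// (le_trans (d_ge0 j)).
Qed.

End FrameTrace.

Lemma eq_mulmx_cV (R : realType) (n : nat) (A B : 'M[R]_n) :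
  (forall z : 'cV[R]_n, A *m z = B *m z) -> A = B.
Proof.
move=> AB; apply/row_matrixP => i; apply: (can_inj (@trmxK _ _ _)).
apply/matrixP => j k; rewrite !mxE.
by have /matrixP/(_ i 0) := AB (delta_mx j 0); rewrite -!colE !mxE.
Qed.

Section Rotation.
Variables (R : realType) (n : nat) (u w : 'cV[R]_n).
Hypotheses (uu : dot u u = 1) (ww : dot w w = 1) (uw : dot u w = 0).

(** When [u] and [w] are orthonormal and [c], [s] are a cosine and a sine, this is
the rotation of their plane that sends [u] to [c u + s w]. *)
Definition plane_rot (c s : R) : 'M[R]_n :=
  1%:M + (c - 1) *: (u *m u^T + w *m w^T) + s *: (w *m u^T - u *m w^T).

Lemma rot_mulE c s z : plane_rot c s *m z =
  z + ((c - 1) * dot u z - s * dot w z) *: u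
    + (s * dot u z + (c - 1) * dot w z) *: w.
Proof.
rewrite /plane_rot !mulmxDl mul1mx -!scalemxAl !mulmxDl mulNmx !mul_outer.
by apply/matrixP => i j; rewrite !mxE; ring.
Qed.

Lemma rot_tr c s : (plane_rot c s)^T = plane_rot c (- s).
Proof.
apply/matrixP => i j; rewrite !mxE !big_ord1 !mxE eq_sym; ring.
Qed.

Lemma rot_id c s z : dot u z = 0 -> dot w z = 0 -> plane_rot c s *m z = z.
Proof.
by move=> uz wz; rewrite rot_mulE uz wz !mulr0 subr0 addr0 !scale0r !addr0.
Qed.

Lemma dot_u_rot c s z : dot u (plane_rot c s *m z) = c * dot u z - s * dot w z.
Proof. by rewrite rot_mulE !dotDr !dotZr uu uw; ring. Qed.

Lemma dot_w_rot c s z : dot w (plane_rot c s *m z) = s * dot u z + c * dot w z.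
Proof. by rewrite rot_mulE !dotDr !dotZr ww (dotC w u) uw; ring. Qed.

Lemma rot_orthogonal c s : c ^+ 2 + s ^+ 2 = 1 ->
  plane_rot c (- s) *m plane_rot c s = 1%:M.
Proof.
move=> cs; have c2 : c ^+ 2 = 1 - s ^+ 2 by rewrite -cs addrK.
apply: eq_mulmx_cV => z; rewrite -mulmxA mul1mx.
rewrite [LHS]rot_mulE dot_u_rot dot_w_rot rot_mulE.
apply/matrixP => i j; rewrite !mxE.
ring: c2.
Qed.

End Rotation.

Section RotationStep.
Variables (R : realType) (alpha : R) (n : nat).
Hypothesis alpha_ge1 : 1 <= alpha.
Variables (B H0 : 'M[R]_n) (g : 'cV[R]_n) (h : R).
Hypothesis B_psd : psdmx B.
Hypothesis H0_sym : H0^T = H0.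
Hypothesis H_ge0 : bordered_ge0 H0 g h.
Local Notation glue := (glued B H0 g h).

Variables (u w : 'cV[R]_n) (a b : R).
Hypotheses (uu : dot u u = 1) (ww : dot w w = 1) (uw : dot u w = 0).
Hypotheses (a_ge0 : 0 <= a) (ab : a < b).
Hypotheses (Bu : B *m u = a *: u) (Bw : B *m w = b *: w).
Hypotheses (H0u : H0 *m u = 0) (H0w : H0 *m w = 0).
Hypotheses (gu : dot g u = 0) (gw : dot g w = 0).
Local Notation plane_rot := (plane_rot u w).

Lemma rot_conj_attach psi c s : c ^+ 2 + s ^+ 2 = 1 ->
  plane_rot c (- s) *m attach H0 g h (plane_rot c s *m psi) *m plane_rot c s =
  attach H0 g h psi.
Proof.
move=> cs; have RtR := rot_orthogonal uu ww uw cs.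
rewrite -[plane_rot c (- s)]rot_tr; apply: attach_conj; rewrite ?rot_tr//.
  apply: eq_mulmx_cV => z; rewrite -mulmxA rot_mulE !mulmxDr -!scalemxAr.
  by rewrite H0u H0w !scaler0 !addr0.
by rewrite rot_id// dotC.
Qed.

Lemma mxtrace_glued psi : \tr (glue psi) =
  \tr B + (\tr H0 + dot psi g + dot psi g + h * dot psi psi).
Proof.
rewrite /glued /attach !mxtraceD mxtraceZ mxtrace_outer.
have tr2 (x y : 'cV[R]_n) : \tr (x *m y^T) = dot y x.
  by rewrite mxtrace_mulC /dot /mxtrace big_ord1.
by rewrite !tr2 (dotC g psi).
Qed.

(** Rotating the matrix back, [psi] is unchanged and only [B] is perturbed, by
[b - a] times a matrix supported on the plane of [u] and [w]. Its entry [s c]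
meets the nonnegative entry [u^T M^(alpha-1) w]; its entries of order [s^2] are
the error. *)
Lemma eigpow_sum_rot psi c s :
  c ^+ 2 + s ^+ 2 = 1 -> 0 <= c -> 0 <= s ->
  0 <= dot psi u -> 0 <= dot psi w ->
  eigpow_sum alpha (glue psi) <= eigpow_sum alpha (glue (plane_rot c s *m psi))
    + alpha * (b - a) * (\tr (glue psi)) `^ (alpha - 1) * s ^+ 2.
Proof.
move=> cs c0 s0 x0 y0; have RtR := rot_orthogonal uu ww uw cs.
have gpsd := glued_psd B_psd H0_sym H_ge0.
pose N := plane_rot c (- s) *m glue (plane_rot c s *m psi) *m plane_rot c s.
have -> : eigpow_sum alpha (glue (plane_rot c s *m psi)) = eigpow_sum alpha N.
  by rewrite /N eigpow_sum_similar.
have Npsd : psdmx N.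
  split; first by rewrite !trmx_mul !rot_tr opprK (proj1 (gpsd _)) mulmxA.
  move=> z; rewrite /N -!mulmxA -[plane_rot c (- s)]trmxK -dot_mulmxl rot_tr opprK.
  exact: (proj2 (gpsd _)).
have NE : N - glue psi = plane_rot c (- s) *m B *m plane_rot c s - B.
  have := rot_conj_attach psi cs; rewrite /N /glued.
  move: (plane_rot c (- s)) => Q; move: (attach _ _ _ (plane_rot c s *m psi)) => X.
  move: (attach _ _ _ psi) (plane_rot c s) => Y P QXP.
  by rewrite mulmxDr mulmxDl QXP opprD addrACA subrr addr0.
have [J [d [v [vF d0 ME]]]] := spectral_frame alpha (gpsd psi).
have := eigpow_sum_tangent alpha_ge1 (gpsd psi) Npsd vF d0 ME.
rewrite NE -lerBrDr => /le_trans; apply; rewrite lerD2l lerNl.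
pose p j := dot u (v j); pose q j := dot w (v j).
have quadE j : dot (v j) ((plane_rot c (- s) *m B *m plane_rot c s - B) *m v j) =
    (b - a) * (s ^+ 2 * (p j ^+ 2 - q j ^+ 2) + 2 * s * c * (p j * q j)).
  have Bsym := proj1 B_psd.
  have Bdot z a' : B *m z = a' *: z -> forall x, dot z (B *m x) = a' * dot z x.
    by move=> Bz x; rewrite -Bsym -dot_mulmxl Bz dotZl.
  rewrite mulmxBl dotBr -!mulmxA -[plane_rot c (- s)]trmxK -dot_mulmxl rot_tr opprK.
  rewrite rot_mulE -/(p j) -/(q j) !mulmxDr -!scalemxAr Bu Bw.
  rewrite !(dotDl, dotDr, dotZl, dotZr) (Bdot _ _ Bu) (Bdot _ _ Bw).
  rewrite uu ww uw (dotC w u) uw (dotC (v j) u) (dotC (v j) w) -/(p j) -/(q j).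
  have c2 : c ^+ 2 = 1 - s ^+ 2 by rewrite -cs addrK.
  ring: c2.
have beta0 : 0 <= alpha - 1 by rewrite subr_ge0.
have off := offdiag_ge0 alpha_ge1 B_psd H0_sym H_ge0 a_ge0 ab Bu Bw uw H0u H0w
  gu gw x0 y0 vF d0.
have diag := frame_eigenvalue_weight_le (proj1 (gpsd psi)) vF d0 w beta0.
rewrite ww mulr1 in diag.
pose Suw := \sum_j d j `^ (alpha - 1) * (p j * q j).
pose Suu := \sum_j d j `^ (alpha - 1) * p j ^+ 2.
pose Sww := \sum_j d j `^ (alpha - 1) * q j ^+ 2.
have -> : \sum_j alpha * d j `^ (alpha - 1) *
      dot (v j) ((plane_rot c (- s) *m B *m plane_rot c s - B) *m v j) =
    alpha * (b - a) * (s ^+ 2 * (Suu - Sww) + 2 * s * c * Suw).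
  rewrite /Suu /Sww /Suw -sumrB !mulr_sumr -big_split mulr_sumr.
  by apply: eq_bigr => j _ /=; rewrite quadE; ring.
have Suu0 : 0 <= Suu.
  by apply: sumr_ge0 => j _; rewrite mulr_ge0 ?powR_ge0 ?sqr_ge0.
rewrite -mulrN -!mulrA; apply: ler_wpM2l; first exact: le_trans alpha_ge1.
apply: ler_wpM2l; first by rewrite subr_ge0 ltW.
rewrite -/Sww in diag; rewrite -/Suw in off.
have := ler_wpM2r (sqr_ge0 s) diag.
have := mulr_ge0 (mulr_ge0 s0 c0) off.
have := mulr_ge0 (sqr_ge0 s) Suu0.
by rewrite [_ * s ^+ 2]mulrC; lra.
Qed.

(** The rotation of angle [t1 - t0] is cut into small ones; the coordinates of the
attaching vector along [u] and [w] stay nonnegative on the way because the angles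
remain in the first quadrant. *)
Lemma eigpow_sum_rotate xi x y x' y' : dot xi u = 0 -> dot xi w = 0 ->
  0 <= x -> 0 <= y -> 0 <= x' -> y <= y' -> x ^+ 2 + y ^+ 2 = x' ^+ 2 + y' ^+ 2 ->
  eigpow_sum alpha (glue (xi + x *: u + y *: w)) <=
  eigpow_sum alpha (glue (xi + x' *: u + y' *: w)).
Proof.
move=> xiu xiw x0 y0 x'0 yy' E.
have [r [t0 [t1 [r0 t0_ge0 t01 t1_le [-> -> -> ->]]]]] :=
  polar_quadrant x0 y0 x'0 yy' E.
pose psi t := xi + (r * cos t) *: u + (r * sin t) *: w.
pose T := \tr B + (\tr H0 + dot xi g + dot xi g + h * (dot xi xi + r ^+ 2)).
have psiT t : \tr (glue (psi t)) = T.
  rewrite mxtrace_glued /psi /T !(dotDl, dotZl) !(dotDr, dotZr).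
  rewrite (dotC u g) (dotC w g) gu gw uu ww uw (dotC w u) uw xiu xiw.
  rewrite (dotC u xi) (dotC w xi) xiu xiw.
  have cs : cos t ^+ 2 = 1 - sin t ^+ 2 by rewrite cos2sin2.
  ring: cs.
pose C := alpha * (b - a) * T `^ (alpha - 1).
have C0 : 0 <= C.
  apply: mulr_ge0; last exact: powR_ge0.
  by apply: mulr_ge0; [exact: le_trans alpha_ge1 | rewrite subr_ge0 ltW].
apply: (@quadratic_defect_nondecreasing R
  (fun t => eigpow_sum alpha (glue (psi t))) t0 t1 C) => //.
move=> s t s_ge t_ge st_le.
have psiD : psi (s + t) = plane_rot (cos t) (sin t) *m psi s.
  rewrite rot_mulE /psi cosD sinD !(dotDr, dotZr).
  rewrite (dotC u xi) (dotC w xi) xiu xiw uu ww uw (dotC w u) uw.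
  by apply/matrixP => i j; rewrite !mxE; ring.
have s0 : 0 <= s by exact: le_trans t0_ge0 s_ge.
have st_pi : s + t <= pi / 2 by exact: le_trans t1_le.
have quad z : 0 <= z -> z <= pi / 2 -> 0 <= cos z /\ 0 <= sin z.
  move=> z0 zpi; rewrite cos_ge0_pihalf ?sin_ge0_pi//.
    by rewrite z0 (le_trans zpi)// ler_pdivrMr// ler_peMr ?pi_ge0 ?ler1n.
  by rewrite zpi andbT (le_trans _ z0)// oppr_le0 divr_ge0 ?pi_ge0.
have [cs0 ss0] : 0 <= cos s /\ 0 <= sin s by apply: quad => //; lra.
have [ct0 st0] : 0 <= cos t /\ 0 <= sin t by apply: quad => //; lra.
rewrite psiD.
have := @eigpow_sum_rot (psi s) (cos t) (sin t) (cos2Dsin2 t) ct0 st0.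
rewrite /psi !dotDl !dotZl xiu xiw uu ww (dotC w u) uw -/(psi s).
rewrite !mulr0 !mulr1 !addr0 !add0r !mulr_ge0// => /(_ isT isT) /le_trans; apply.
by rewrite lerD2l psiT -/C ler_wpM2l ?sqr_sin_le.
Qed.

End RotationStep.

(** * Moving spectral weight to larger eigenvalues *)

Section Transport.
Variables (R : realType) (alpha : R) (n : nat).
Hypothesis alpha_ge1 : 1 <= alpha.
Variables (B H0 : 'M[R]_n) (g : 'cV[R]_n) (h : R).
Hypothesis B_psd : psdmx B.
Hypothesis H0_sym : H0^T = H0.
Hypothesis H_ge0 : bordered_ge0 H0 g h.
Local Notation F psi := (eigpow_sum alpha (glued B H0 g h psi)).

Variables (m : nat) (phi : 'I_m -> 'cV[R]_n) (lam : 'I_m -> R).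
Hypothesis phi_on : forall i j, dot (phi i) (phi j) = (i == j)%:R.
Hypothesis B_phi : forall i, B *m phi i = lam i *: phi i.
Hypothesis lam_ge0 : forall i, 0 <= lam i.
Hypothesis lam_lt : forall i j : 'I_m, (i < j)%N -> lam i < lam j.
Hypothesis H0_phi : forall i, H0 *m phi i = 0.
Hypothesis g_phi : forall i, dot g (phi i) = 0.

Definition combo (x : 'I_m -> R) : 'cV[R]_n := \sum_i x i *: phi i.

Lemma dot_combo (P : pred 'I_m) (x : 'I_m -> R) i : ~~ P i ->
  dot (\sum_(j | P j) x j *: phi j) (phi i) = 0.
Proof.
move=> Pi; rewrite dot_suml big1 // => j Pj.
by rewrite dotZl phi_on; case: eqVneq Pj Pi => [->->|]; rewrite ?mulr0.
Qed.

Let refl (u : 'cV[R]_n) : 'M[R]_n := 1%:M - 2 *: (u *m u^T).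

Lemma eigpow_sum_flip i xi c : dot xi (phi i) = 0 ->
  F (xi + c *: phi i) = F (xi - c *: phi i).
Proof.
move=> xii; set u := phi i; have uu : dot u u = 1 by rewrite phi_on eqxx.
have PE z : refl u *m z = z - (2 * dot u z) *: u.
  by rewrite mulmxBl mul1mx -scalemxAl mul_outer scalerA.
have Pt : (refl u)^T = refl u.
  by apply/matrixP => k l; rewrite !mxE !big_ord1 !mxE eq_sym [u k 0 * _]mulrC.
have PP : refl u *m refl u = 1%:M.
  apply: eq_mulmx_cV => z; rewrite -mulmxA mul1mx !PE dotBr dotZr uu.
  by apply/matrixP => k l; rewrite !mxE; ring.
have PB : refl u *m B *m refl u = B.
  apply: eq_mulmx_cV => z; rewrite -!mulmxA !PE mulmxBr -scalemxAr.
  have Buz : dot u (B *m z) = lam i * dot u z.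
    by rewrite -(proj1 B_psd) -dot_mulmxl B_phi dotZl.
  rewrite B_phi dotBr !dotZr uu Buz.
  by apply/matrixP => k l; rewrite !mxE; ring.
have -> : xi - c *: u = refl u *m (xi + c *: u).
  rewrite PE dotDr dotZr uu (dotC u) xii.
  by apply/matrixP => k l; rewrite !mxE; ring.
rewrite -(eigpow_sum_similar alpha (glued _ _ _ _ (_ *m _)) PP).
congr (eigpow_sum _ _).
have := @attach_conj _ _ H0 g h H0_sym (refl u) (xi + c *: u).
rewrite Pt PP => E; have {}E := E erefl.
rewrite /glued; move: (attach _ _ _ (_ *m _)) (attach _ _ _ (_ + _)) E => X Y E.
have H0P : H0 *m refl u = H0.
  apply: eq_mulmx_cV => z; rewrite -mulmxA PE mulmxBr -scalemxAr H0_phi.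
  by rewrite scaler0 subr0.
have Pg : refl u *m g = g by rewrite PE dotC g_phi mulr0 scale0r subr0.
move: (refl u) PB {PE Pt PP} H0P Pg E => P PB H0P Pg E.
by rewrite mulmxDr mulmxDl PB E.
Qed.

(** The reflection that changes the sign of one eigenvector of [B] commutes with
[B]. *)
Lemma eigpow_sum_norm x : F (combo x) = F (combo (fun i => `|x i|)).
Proof.
pose mid K (i : 'I_m) := if (i < K)%N then `|x i| else x i.
suff H K : (K <= m)%N -> F (combo (mid K)) = F (combo x).
  rewrite -(H m (leqnn m)); congr (F _).
  by apply: eq_bigr => i _; rewrite /mid ltn_ord.
elim: K => [|K IH] Km; first by congr (F _); apply: eq_bigr => i _.
rewrite -(IH (ltnW Km)); pose k := Ordinal Km.
pose xi := \sum_(i | i != k) mid K i *: phi i.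
have xik : dot xi (phi k) = 0 by apply: dot_combo; rewrite eqxx.
have comboE z : (forall i, i != k -> z i = mid K i) -> combo z = xi + z k *: phi k.
  move=> zE; rewrite /combo (bigD1 k isT) /= addrC; congr (_ + _).
  by apply: eq_bigr => i ik; rewrite zE.
have -> : combo (mid K) = xi + x k *: phi k.
  by rewrite comboE; [rewrite /mid ltnn | move=> i _].
have -> : combo (mid K.+1) = xi + `|x k| *: phi k.
  rewrite comboE => [|i ik]; first by rewrite /mid ltnSn.
  by rewrite /mid ltnS leq_eqVlt (negPf (ik : (i : nat) != K)).
case: (ger0P (x k)) => _; first by [].
by rewrite scaleNr -eigpow_sum_flip.
Qed.

(** Weight is pushed from each eigenvector to the next, starting from the lowest:
after step [K] the coordinates below [K] have reached their targets and
coordinate [K] holds all the excess [c K]. In this order no coordinate ever runs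
out of weight. *)
Lemma eigpow_sum_transport (x y : 'I_m -> R) :
  (forall i, 0 <= x i) -> (forall i, 0 <= y i) ->
  \sum_i x i ^+ 2 = \sum_i y i ^+ 2 ->
  (forall K : nat,
     \sum_(i < m | (i < K)%N) y i ^+ 2 <= \sum_(i < m | (i < K)%N) x i ^+ 2) ->
  F (combo x) <= F (combo y).
Proof.
move=> x0 y0 xyE xyK; have [m0|m_gt0] := posnP m.
  suff -> : combo x = combo y by [].
  by apply: eq_bigr => i; case: (i) => k km; exfalso; rewrite m0 in km.
pose c K := \sum_(i < m | (i < K)%N) (x i ^+ 2 - y i ^+ 2).
have c0 K : 0 <= c K by rewrite /c sumrB subr_ge0.
have cS (k : 'I_m) : c k.+1 = c k + (x k ^+ 2 - y k ^+ 2).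
  rewrite /c (bigD1 k) /= ?ltnSn// addrC; congr (_ + _).
  apply: eq_bigl => i; rewrite ltnS leq_eqVlt -val_eqE /=.
  by case: ltngtP.
pose s (k : 'I_m) := Num.sqrt (x k ^+ 2 + c k).
have s2 k : s k ^+ 2 = x k ^+ 2 + c k.
  by rewrite sqr_sqrtr// addr_ge0 ?sqr_ge0.
pose mid K (i : 'I_m) :=
  if (i < K)%N then y i else if i == K :> nat then s i else x i.
have mid0 : combo (mid 0%N) = combo x.
  apply: eq_bigr => i _; rewrite /mid ltn0; case: eqP => // i0.
  by rewrite /s /c i0 big_pred0// addr0 sqrtr_sqr ger0_norm.
have midm : combo (mid m.-1) = combo y.
  apply: eq_bigr => i _; rewrite /mid; case: ifP => // iN.
  have im : i = m.-1 :> nat.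
    by apply/eqP; rewrite eqn_leq -ltnS prednK// ltn_ord leqNgt iN.
  rewrite im eqxx; congr (_ *: _).
  have : c i.+1 = 0.
    rewrite /c im prednK// (eq_bigl xpredT) => [|j]; last by rewrite ltn_ord.
    by rewrite sumrB xyE subrr.
  rewrite cS => /eqP; rewrite addrA subr_eq0 addrC -s2 => /eqP.
  by move=> /(congr1 Num.sqrt); rewrite !sqrtr_sqr !ger0_norm ?sqrtr_ge0.
suff H K : (K < m)%N -> F (combo x) <= F (combo (mid K)).
  by rewrite -midm H// prednK.
elim: K => [|K IH] Km; first by rewrite mid0.
apply: le_trans (IH (ltnW Km)) _.
pose k := Ordinal (ltnW Km); pose l := Ordinal Km.
have kl : k != l by rewrite -val_eqE /= neq_ltn ltnSn.
pose xi := \sum_(i | (i != k) && (i != l)) mid K i *: phi i.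
have comboE z : (forall i, i != k -> i != l -> z i = mid K i) ->
    combo z = xi + z k *: phi k + z l *: phi l.
  move=> zE; rewrite /combo (bigD1 k isT) /= (bigD1 l) /=; last by rewrite eq_sym.
  rewrite addrA addrC -[RHS]addrA; congr (_ + _).
  by apply: eq_bigr => i /andP[ik il]; rewrite zE.
rewrite (comboE (mid K)) ?(comboE (mid K.+1)); first last.
- by move=> i _ _.
- move=> i ik il; rewrite /mid ltnS (negPf (il : i != K.+1 :> nat)).
  by rewrite leq_eqVlt (negPf (ik : i != K :> nat)).
have -> : mid K k = s k by rewrite /mid ltnn eqxx.
have -> : mid K l = x l by rewrite /mid /= ltnNge leqnSn /= gtn_eqF.
have -> : mid K.+1 k = y k by rewrite /mid ltnSn.
have -> : mid K.+1 l = s l by rewrite /mid /= ltnn eqxx.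
have xik : dot xi (phi k) = 0 by apply: dot_combo; rewrite eqxx.
have xil : dot xi (phi l) = 0 by apply: dot_combo; rewrite eqxx andbF.
apply: (eigpow_sum_rotate alpha_ge1 B_psd H0_sym H_ge0
  (a := lam k) (b := lam l)) => //; rewrite ?phi_on ?eqxx ?(negPf kl) //.
- exact: lam_lt.
- exact: sqrtr_ge0.
- rewrite -(ler_pXn2r (ltn0Sn 1)) ?nnegrE ?sqrtr_ge0//.
  by rewrite s2 lerDl.
by rewrite !s2 (cS k : c l = _); ring.
Qed.

End Transport.

(** * A trigonometric inequality *)

Section Trigonometry.
Variable R : realType.
Implicit Types x y a : R.

(** The Dirichlet kernel. *)
Lemma sin_dirichlet a K :
  sin a * (1 + 2 * \sum_(k < K) cos (k.+1%:R * (2 * a))) = sin ((2 * K + 1)%:R * a).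
Proof.
elim: K => [|K IH].
  by rewrite big_ord0 mulr0 addr0 mulr1 muln0 add0n mul1r.
rewrite big_ord_recr /=; move: (\sum_(k < K) _) IH => S IH.
rewrite [2 * (S + _)]mulrDr addrA mulrDr {}IH.
have -> : (2 * K + 1)%:R * a = K.+1%:R * (2 * a) - a.
  by rewrite natrD natrM -natr1; ring.
have -> : (2 * K.+1 + 1)%:R * a = K.+1%:R * (2 * a) + a.
  by rewrite natrD natrM; ring.
by rewrite sinB sinD; ring.
Qed.

Lemma sin_sum_cos_odd a N :
  2 * sin a * (\sum_(i < N) cos ((2 * i + 1)%:R * a)) = sin ((2 * N)%:R * a).
Proof.
elim: N => [|N IH]; first by rewrite big_ord0 mulr0 muln0 mul0r sin0.
rewrite big_ord_recr /= mulrDr {}IH.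
have -> : (2 * N)%:R * a = (2 * N + 1)%:R * a - a by rewrite natrD; ring.
have -> : (2 * N.+1)%:R * a = (2 * N + 1)%:R * a + a.
  by rewrite mulnS addnC natrD natrD; ring.
by rewrite sinB sinD; ring.
Qed.

Lemma cos_nonincreasing x y : 0 <= x -> x <= y -> y <= pi -> cos y <= cos x.
Proof.
move=> x0; rewrite le_eqVlt => /predU1P[->//|xy] ypi.
have y0 := le_trans x0 (ltW xy); have xpi := le_trans (ltW xy) ypi.
by rewrite ltW// ltr_cos// in_itv /= ?x0 ?y0.
Qed.

Lemma sin_nondecreasing x y : 0 <= x -> x <= y -> y <= pi / 2 -> sin x <= sin y.
Proof.
move=> x0 xy ypi; rewrite -(cosBpihalf x) -(cosBpihalf y).
rewrite -(cosN (x - _)) -(cosN (y - _)) !opprB.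
have := pi_ge0 R; move: ypi; rewrite ler_pdivlMr// => ypi pi0.
apply: cos_nonincreasing; rewrite ?subr_ge0 ?ler_pdivlMr// ?lerD2l ?lerN2//.
by rewrite lerBlDr ler_pdivrMr//; lra.
Qed.

(** In other words [sin (r t) / sin t] is nonincreasing up to [pi / r]. The
induction on [r] expands [sin ((r + 1) t)]; it needs [cos y] nonnegative, which
holds since [y <= pi / 2] as soon as [r + 1 >= 2]. *)
Lemma sin_ratio_nonincreasing r x y : 0 <= x -> x <= y -> r%:R * y <= pi ->
  sin (r%:R * y) * sin x <= sin (r%:R * x) * sin y.
Proof.
move=> x0 xy; have y0 := le_trans x0 xy.
elim: r => [|[|r] IH] ry; first by rewrite !mul0r sin0 !mul0r.
  by rewrite !mul1r mulrC.
have ry' : r.+1%:R * y <= pi.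
  by apply: le_trans ry; rewrite ler_wpM2r// ler_nat.
have {}IH := IH ry'.
have rx : r.+1%:R * x <= r.+1%:R * y by rewrite ler_wpM2l.
have rx0 : 0 <= r.+1%:R * x by rewrite mulr_ge0.
have y2 : y <= pi / 2.
  rewrite ler_pdivlMr//; apply: le_trans ry.
  by rewrite mulrC ler_wpM2r// ler_nat.
have ypi : y <= pi by apply: le_trans ry'; rewrite ler_peMl// ler1n.
have cosr := cos_nonincreasing rx0 rx ry'.
have cosxy := cos_nonincreasing x0 xy ypi.
have cy0 : 0 <= cos y.
  by rewrite cos_ge0_pihalf// y2 andbT (le_trans _ y0)// oppr_le0 divr_ge0 ?pi_ge0.
have sx0 : 0 <= sin x by rewrite sin_ge0_pi// x0 (le_trans xy).
have sy0 : 0 <= sin y by rewrite sin_ge0_pi// y0.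
have srx0 : 0 <= sin (r.+1%:R * x).
  by rewrite sin_ge0_pi// rx0 (le_trans rx).
rewrite -[r.+2%:R]natr1 !mulrDl !mul1r !sinD.
move: (sin (r.+1%:R * x)) (sin (r.+1%:R * y)) IH srx0 => Sx Sy IH Sx0.
move: (cos (r.+1%:R * x)) (cos (r.+1%:R * y)) cosr => Cx Cy CC.
move: (sin x) (sin y) (cos x) (cos y) sx0 sy0 cy0 cosxy IH => sx sy cx cy.
move=> sx0 sy0 cy0 cxy IH.
have h1 := ler_wpM2r cy0 IH.
have h2 := ler_wpM2l (mulr_ge0 Sx0 sy0) cxy.
have h3 := ler_wpM2l (mulr_ge0 sx0 sy0) CC.
by lra.
Qed.

Variable m : nat.
Hypothesis m_gt0 : (0 < m)%N.
Let theta : R := pi / (2 * m)%:R.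

Let thetaE : (2 * m)%:R * theta = pi.
Proof.
by rewrite /theta mulrC divfK// pnatr_eq0 -lt0n muln_gt0.
Qed.

Let theta_gt0 : 0 < theta.
Proof. by rewrite divr_gt0 ?pi_gt0// ltr0n muln_gt0. Qed.

Let natr_theta_le r : (r <= m)%N -> r%:R * theta <= pi / 2.
Proof.
move=> rm; rewrite ler_pdivlMr// -thetaE natrM.
have : r%:R * theta <= m%:R * theta by rewrite ler_wpM2r ?ler_nat// ltW.
by lra.
Qed.

(** If [r s theta <= pi], the ratio [sin (r t) / sin t] decreases from [theta] to
[s theta]. Otherwise it decreases from [theta] to [pi / (2 r)], where
[sin (r t) = 1], and [pi / (2 r) <= s theta]. *)
Lemma sin_product_half r s : (0 < r <= m)%N -> (0 < s <= m)%N ->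
  sin ((r * s)%:R * theta) * sin theta <= sin (r%:R * theta) * sin (s%:R * theta).
Proof.
move=> /andP[r0 rm] /andP[s0 sm]; rewrite natrM -mulrA.
have th0 := ltW theta_gt0.
have st : theta <= s%:R * theta by rewrite ler_peMl// ler1n.
have [le_pi|gt_pi] := leP (r%:R * (s%:R * theta)) pi.
  exact: sin_ratio_nonincreasing.
have rR0 : 0 < r%:R :> R by rewrite ltr0n.
pose y : R := pi / 2 / r%:R.
have ry : r%:R * y = pi / 2 by rewrite /y mulrC divfK// gt_eqF.
have ty : theta <= y.
  by rewrite -(ler_pM2l rR0) ry natr_theta_le.
have ys : y <= s%:R * theta.
  rewrite -(ler_pM2l rR0) ry; apply: le_trans (ltW gt_pi).
  by rewrite ler_pdivrMr// ler_peMr ?pi_ge0// ler1n.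
have pi2 : pi / 2 <= pi :> R by rewrite ler_pdivrMr// ler_peMr ?pi_ge0// ler1n.
have sr0 : 0 <= sin (r%:R * theta).
  rewrite sin_ge0_pi// mulr_ge0//=.
  exact: le_trans (natr_theta_le rm) _.
have st0 : 0 <= sin theta.
  by rewrite sin_ge0_pi// th0 (le_trans st)// (le_trans (natr_theta_le sm)).
apply: le_trans (_ : 1 * sin theta <= _); first by rewrite ler_wpM2r ?sin_le1.
have := @sin_ratio_nonincreasing r theta y th0 ty.
rewrite ry sin_pihalf => /(_ pi2) /le_trans; apply.
rewrite ler_wpM2l// sin_nondecreasing// ?natr_theta_le//.
by rewrite (le_trans th0).
Qed.

Let sin_reflect r s : (r <= 2 * m)%N -> odd s ->
  sin (((2 * m - r) * s)%:R * theta) = sin ((r * s)%:R * theta).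
Proof.
move=> r2m os.
have -> : ((2 * m - r) * s)%:R * theta = - ((r * s)%:R * theta) + pi *+ s.
  by rewrite -thetaE -mulr_natr natrM natrB// [(r * s)%:R]natrM; ring.
rewrite (alternatingn (@sinDpi R)) -signr_odd os expr1 sinN; ring.
Qed.

(** Replacing [r] by [2 m - r] changes neither side when [s] is odd, and likewise
for [s]; so both may be assumed at most [m]. *)
Lemma sin_product r s : odd r -> odd s -> (r < 2 * m)%N -> (s < 2 * m)%N ->
  sin ((r * s)%:R * theta) * sin theta <= sin (r%:R * theta) * sin (s%:R * theta).
Proof.
have half r' s' : odd s' -> (r' < 2 * m)%N -> (0 < r')%N -> (0 < s' <= m)%N ->
    sin ((r' * s')%:R * theta) * sin theta <=
    sin (r'%:R * theta) * sin (s'%:R * theta).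
  move=> os r2m r0 sm; have [rm|rm] := leqP r' m.
    by apply: sin_product_half; rewrite ?r0.
  rewrite -(sin_reflect (ltnW r2m) os) -[r' in leRHS]muln1 -(sin_reflect (ltnW r2m))//.
  rewrite muln1; apply: sin_product_half => //.
  by rewrite subn_gt0 r2m leq_subLR mul2n -addnn leq_add2r ltnW.
move=> ro so r2m s2m; have r0 : (0 < r)%N by case: (r) ro.
have s0 : (0 < s)%N by case: (s) so.
have [sm|sm] := leqP s m; first by apply: half; rewrite ?s0.
rewrite mulnC -(sin_reflect (ltnW s2m) ro).
rewrite -[s in leRHS]muln1 -(sin_reflect (ltnW s2m))// muln1.
rewrite mulnC; apply: half => //.
  by rewrite (oddB (ltnW s2m)) mul2n odd_double so.
by rewrite subn_gt0 s2m leq_subLR mul2n -addnn leq_add2r ltnW.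
Qed.

End Trigonometry.

(** * The spectrum of a path *)

Section PathMatrix.
Variables (R : realType) (n : nat) (sigma : R).
Hypothesis sigma2 : sigma ^+ 2 = 1.

Definition bvec (x : 'I_n) : 'cV[R]_n := delta_mx x 0.

Lemma dot_bvec x z : dot (bvec x) z = z x 0.
Proof.
rewrite dotE (bigD1 x)//= mxE !eqxx mul1r big1 ?addr0// => i ix.
by rewrite mxE (negPf ix) mul0r.
Qed.

Lemma dot_bvec2 x y : dot (bvec x) (bvec y) = (x == y)%:R.
Proof. by rewrite dot_bvec mxE eqxx andbT. Qed.

(** The Laplacian of a single edge for [sigma = 1], its signless Laplacian for
[sigma = -1]. *)
Definition edgemx (x y : 'I_n) : 'M[R]_n :=
  let e := bvec x - sigma *: bvec y in e *m e^T.

Fixpoint pathmx (x : 'I_n) (p : seq 'I_n) : 'M[R]_n :=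
  if p is y :: p' then edgemx x y + pathmx y p' else 0.

Lemma edgemx_quad x y z :
  dot z (edgemx x y *m z) = (z x 0 - sigma * z y 0) ^+ 2.
Proof.
rewrite /edgemx mul_outer dotZr (dotC z) dotBl dotZl !dot_bvec; ring.
Qed.

Lemma edgemx_tr x y : (edgemx x y)^T = edgemx x y.
Proof. by rewrite /edgemx trmx_mul trmxK. Qed.

Lemma edgemx_supp (x y z : 'I_n) : z != x -> z != y -> edgemx x y *m bvec z = 0.
Proof.
move=> zx zy; rewrite /edgemx mul_outer dotBl dotZl !dot_bvec2.
by rewrite ![_ == z]eq_sym (negPf zx) (negPf zy) mulr0 subr0 scale0r.
Qed.

Lemma edgemx_psd x y : psdmx (edgemx x y).
Proof.
by split=> [|z]; rewrite ?edgemx_tr// edgemx_quad sqr_ge0.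
Qed.

Lemma edgemxC x y : edgemx x y = edgemx y x.
Proof.
have E : bvec x - sigma *: bvec y = - sigma *: (bvec y - sigma *: bvec x).
  by rewrite scalerBr scalerA mulNr -expr2 sigma2 !scaleNr scale1r opprK addrC.
rewrite /edgemx /= E; move: (bvec y - _) => v.
have -> : (- sigma *: v)^T = - sigma *: v^T by rewrite linearZ.
by rewrite -scalemxAl -scalemxAr scalerA mulrNN -expr2 sigma2 scale1r.
Qed.

Lemma pathmx_tr x p : (pathmx x p)^T = pathmx x p.
Proof.
by elim: p x => [|y p IH] x /=; rewrite ?trmx0// linearD /= edgemx_tr IH.
Qed.

Lemma pathmx_psd x p : psdmx (pathmx x p).
Proof.
split=> [|z]; first exact: pathmx_tr.
elim: p x => [|y p IH] x /=; first by rewrite mul0mx dot0r.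
by rewrite mulmxDl dotDr edgemx_quad addr_ge0 ?sqr_ge0.
Qed.

Lemma pathmx_nth x0 x p : pathmx x p =
  \sum_(i < size p) edgemx (nth x0 (x :: p) i) (nth x0 (x :: p) i.+1).
Proof.
elim: p x => [|y p IH] x /=; first by rewrite big_ord0.
by rewrite big_ord_recl /= IH.
Qed.

Lemma pathmx_supp x p z : z \notin x :: p -> pathmx x p *m bvec z = 0.
Proof.
elim: p x => [|y p IH] x /=; first by rewrite mul0mx.
rewrite inE negb_or => /andP[zx zp]; rewrite mulmxDl (IH y zp) addr0.
by move: zp; rewrite inE negb_or => /andP[zy _]; exact: edgemx_supp.
Qed.

Section PathSpectrum.
Variables (x : 'I_n) (p : seq 'I_n).
Hypothesis p_uniq : uniq (x :: p).
Local Notation m := (size p).+1.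

Definition path_angle : R := pi / (2 * m)%:R.
Definition pvec (i : nat) : 'cV[R]_n := bvec (nth x (x :: p) i).

Lemma dot_pvec (i j : nat) : (i < m)%N -> (j < m)%N ->
  dot (pvec i) (pvec j) = (i == j)%:R.
Proof. by move=> im jm; rewrite dot_bvec2 nth_uniq. Qed.

(** The modes of a path with free ends, sampled at the odd multiples [2 i + 1] of
half a step. The constant mode has its own normalization, and the signs
[sigma ^+ i] adapt the modes to the signless case. *)
Definition pcos (k i : nat) : R :=
  cos ((2 * i + 1)%:R * (k%:R * path_angle)).
Definition pnorm (k : nat) : R := Num.sqrt ((k != 0)%N.+1%:R / m%:R).
Definition pcoef (i k : nat) : R := sigma ^+ i * (pnorm k * pcos k i).
Definition pmode (k : nat) : 'cV[R]_n := \sum_(i < m) pcoef i k *: pvec i.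
Definition peig (k : nat) : R := 2 - 2 * cos (2 * (k%:R * path_angle)).

Let mangle : (2 * m)%:R * path_angle = pi.
Proof. by rewrite /path_angle mulrC divfK// pnatr_eq0. Qed.

Let angle_gt0 : 0 < path_angle.
Proof. by rewrite divr_gt0 ?pi_gt0// ltr0n. Qed.

Lemma dot_pvec_pmode (i k : nat) : (i <= size p)%N ->
  dot (pvec i) (pmode k) = pcoef i k.
Proof.
move=> im; rewrite dot_sumr (bigD1 (Ordinal (im : (i < m)%N)))//= dotZr.
rewrite dot_pvec// eqxx mulr1 big1 ?addr0// => j ji.
by rewrite dotZr dot_pvec// eq_sym (negPf (ji : j != i :> nat)) mulr0.
Qed.

(** Summation by parts: [E i] is the jump of the mode across the edge between the
positions [i - 1] and [i]. It vanishes at both ends, [i = 0] and [i = m], because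
the cosine is even about these two half-integer positions. *)
Lemma pmode_eigen k : pathmx x p *m pmode k = peig k *: pmode k.
Proof.
pose a := k%:R * path_angle.
pose E (i : nat) := pnorm k * (cos ((2 * i%:R - 1) * a) - cos ((2 * i%:R + 1) * a)).
have pcosE i : pcos k i = cos ((2 * i%:R + 1) * a) by rewrite /pcos natrD natrM.
have E0 : E 0%N = 0.
  by rewrite /E mulr0 sub0r add0r mulN1r mul1r cosN subrr mulr0.
have Em : E m = 0.
  rewrite /E.
  have -> : (2 * m%:R - 1) * a = - a + pi *+ k.
    by rewrite -mangle -mulr_natr natrM /a; ring.
  have -> : (2 * m%:R + 1) * a = a + pi *+ k.
    by rewrite -mangle -mulr_natr natrM /a; ring.
  by rewrite !(alternatingn (@cosDpi R)) cosN subrr mulr0.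
have edgeE (i : 'I_(size p)) :
    edgemx (nth x (x :: p) i) (nth x (x :: p) i.+1) *m pmode k =
    (sigma ^+ i * E i.+1) *: pvec i - (sigma ^+ i.+1 * E i.+1) *: pvec i.+1.
  rewrite /edgemx mul_outer -!/(pvec _) dotBl dotZl.
  rewrite !dot_pvec_pmode//; last exact: ltnW.
  rewrite /pcoef !pcosE.
  have -> : sigma ^+ i * (pnorm k * cos ((2 * i%:R + 1) * a)) -
       sigma * (sigma ^+ i.+1 * (pnorm k * cos ((2 * i.+1%:R + 1) * a))) =
     sigma ^+ i * E i.+1.
    rewrite exprS /E -[i.+1%:R]natr1.
    have -> : 2 * (i%:R + 1) - 1 = 2 * i%:R + 1 :> R by ring.
    ring: sigma2.
  by rewrite scalerBr scalerA exprS; congr (_ *: _ - _ *: _); ring.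
rewrite (pathmx_nth x) mulmx_suml (eq_bigr _ (fun i _ => edgeE i)) sumrB.
have -> : \sum_(i < size p) (sigma ^+ i * E i.+1) *: pvec i =
          \sum_(i < m) (sigma ^+ i * E i.+1) *: pvec i.
  by rewrite [RHS]big_ord_recr /= Em mulr0 scale0r addr0.
have -> : \sum_(i < size p) (sigma ^+ i.+1 * E i.+1) *: pvec i.+1 =
          \sum_(i < m) (sigma ^+ i * E i) *: pvec i.
  by rewrite [RHS]big_ord_recl /= E0 mulr0 scale0r add0r.
rewrite -sumrB scaler_sumr; apply: eq_bigr => i _.
rewrite -scalerBl scalerA; congr (_ *: _).
rewrite /pcoef pcosE /E /peig -[i.+1%:R]natr1.
have -> : (2 * (i%:R + 1) - 1) * a = (2 * i%:R + 1) * a by ring.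
have -> : (2 * (i%:R + 1) + 1) * a = (2 * i%:R + 1) * a + 2 * a by ring.
have -> : (2 * i%:R - 1) * a = (2 * i%:R + 1) * a - 2 * a by ring.
rewrite -/a cosD cosB; ring.
Qed.

Lemma peig_ge0 k : 0 <= peig k.
Proof. by rewrite subr_ge0 ler_piMr// cos_le1. Qed.

Lemma peig_lt (k l : nat) : (k < l)%N -> (l < m)%N -> peig k < peig l.
Proof.
move=> kl lm; have ang (j : nat) : (j < m)%N -> 0 <= 2 * (j%:R * path_angle) <= pi.
  move=> jm; apply/andP; split.
    by rewrite mulr_ge0// mulr_ge0 ?ler0n// ltW.
  rewrite -mangle natrM -mulrA ler_wpM2l// ler_wpM2r ?ltW// ltr_nat//.
rewrite /peig ltrD2l ltrN2 ltr_pM2l// ltr_cos ?in_itv /= ?ang ?(ltn_trans kl)//.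
by rewrite ltr_pM2l// ltr_pM2r// ltr_nat.
Qed.

Lemma sum_sqr_pcoef (k : nat) : (k < m)%N -> \sum_(i < m) pcoef i k ^+ 2 = 1.
Proof.
move=> km; have mR : m%:R != 0 :> R by rewrite pnatr_eq0.
have n2 : pnorm k ^+ 2 = (k != 0)%N.+1%:R / m%:R.
  by rewrite sqr_sqrtr// divr_ge0.
have s2 i : (sigma ^+ i) ^+ 2 = 1 by rewrite exprAC sigma2 expr1n.
pose a := 2 * (k%:R * path_angle).
have c2 i : pcos k i ^+ 2 = (1 + cos ((2 * i + 1)%:R * a)) / 2.
  have -> : (2 * i + 1)%:R * a = ((2 * i + 1)%:R * (k%:R * path_angle)) *+ 2.
    by rewrite /a -mulr_natl; ring.
  by rewrite cos_mulr2n /pcos; set c := cos _; rewrite mulr2n; field.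
transitivity (pnorm k ^+ 2 / 2 * (m%:R + \sum_(i < m) cos ((2 * i + 1)%:R * a))).
  have -> : m%:R = \sum_(i < m) 1 :> R by rewrite sumr_const card_ord.
  rewrite -big_split mulr_sumr; apply: eq_bigr => i _ /=.
  by rewrite /pcoef !exprMn s2 mul1r c2; field.
rewrite n2; have [k0|k0] := eqVneq k 0%N.
  have -> : \sum_(i < m) cos ((2 * i + 1)%:R * a) = m%:R.
    rewrite /a k0 (eq_bigr (fun=> 1)) ?sumr_const ?card_ord// => i _.
    by rewrite mul0r !mulr0 cos0.
  by rewrite /=; move: (m%:R) mR => mm mR; field.
have -> : \sum_(i < m) cos ((2 * i + 1)%:R * a) = 0.
  have := sin_sum_cos_odd a m.
  have -> : (2 * m)%:R * a = 0 + pi *+ (2 * k).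
    by rewrite -mangle -mulr_natr !natrM /a; ring.
  rewrite (alternatingn (@sinDpi R)) sin0 mulr0 => /eqP.
  rewrite !mulf_eq0 pnatr_eq0 /= gt_eqF /=; first by move/eqP.
  apply: sin_gt0_pi; rewrite mulr_gt0//=; last first.
    by rewrite mulr_gt0// ltr0n lt0n.
  by rewrite -mangle natrM -mulrA ltr_pM2l// ltr_pM2r// ltr_nat.
by rewrite /= addr0; move: (m%:R) mR => mm mR; field.
Qed.

(** Modes with distinct eigenvalues of a symmetric matrix are orthogonal. *)
Lemma dot_pmode (k l : 'I_m) : dot (pmode k) (pmode l) = (k == l)%:R.
Proof.
have [->|kl] := eqVneq k l.
  rewrite -[RHS](sum_sqr_pcoef (ltn_ord l)) dot_suml; apply: eq_bigr => i _.
  by rewrite dotZl dot_pvec_pmode ?expr2// -ltnS.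
apply/eqP; have := dot_mulmxl (pathmx x p) (pmode k) (pmode l).
rewrite pathmx_tr !pmode_eigen dotZl dotZr => /eqP.
rewrite -subr_eq0 -mulrBl mulf_eq0 subr_eq0 => /orP[|//].
move: kl; rewrite -val_eqE neq_ltn => /orP[] lt_kl /eqP E.
  by have := peig_lt lt_kl (ltn_ord l); rewrite E ltxx.
by have := peig_lt lt_kl (ltn_ord k); rewrite E ltxx.
Qed.

(** The modes are orthonormal and as many as the vertices, so the coefficient
matrix is orthogonal. *)
Lemma pcoef_rows (i j : 'I_m) : \sum_(k < m) pcoef i k * pcoef j k = (i == j)%:R.
Proof.
pose P : 'M[R]_m := \matrix_(i, k) pcoef i k.
have PtP : P^T *m P = 1%:M.
  apply/matrixP => k l; rewrite !mxE -dot_pmode dot_suml; apply: eq_bigr => i' _.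
  by rewrite !mxE dotZl dot_pvec_pmode// -ltnS.
have /matrixP/(_ i j) := mulmx1C PtP; rewrite !mxE => <-.
by apply: eq_bigr => k _; rewrite !mxE.
Qed.

Lemma pvec_combo (j : 'I_m) : pvec j = combo (fun k : 'I_m => pmode k) (pcoef j).
Proof.
have -> : combo (fun k : 'I_m => pmode k) (pcoef j) =
    \sum_(i < m) (\sum_(k < m) pcoef j k * pcoef i k) *: pvec i.
  rewrite /combo /pmode; under eq_bigr do rewrite scaler_sumr.
  rewrite exchange_big; apply: eq_bigr => i _; rewrite scaler_suml.
  by apply: eq_bigr => k _; rewrite scalerA.
rewrite (bigD1 j)//= pcoef_rows eqxx scale1r big1 ?addr0// => i ij.
by rewrite pcoef_rows eq_sym (negPf ij) scale0r.
Qed.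

(** The squared coordinates of a vertex along the modes form its spectral measure.
Its partial sums are Dirichlet kernels at the odd multiples [2 j + 1] of the path
angle, compared by [sin_product]: the measure of the end vertex [0] sits lower
than that of any other vertex. *)
Lemma pcoef_dominance (j K : nat) : (j < m)%N ->
  \sum_(k < m | (k < K)%N) pcoef j k ^+ 2 <= \sum_(k < m | (k < K)%N) pcoef 0 k ^+ 2.
Proof.
move=> jm.
have s2 i : (sigma ^+ i) ^+ 2 = 1 by rewrite exprAC sigma2 expr1n.
have [mK|Km] := leqP m K.
  have full i (im : (i < m)%N) : \sum_(k < m | (k < K)%N) pcoef i k ^+ 2 = 1.
    rewrite (eq_bigl xpredT) => [|k]; last by rewrite (leq_trans (ltn_ord k)).
    have := pcoef_rows (Ordinal im) (Ordinal im); rewrite eqxx mulr1n => <-.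
    by apply: eq_bigr => k _; rewrite expr2.
  by rewrite !full.
have widen i : \sum_(k < m | (k < K)%N) pcoef i k ^+ 2 =
    \sum_(k < K) pcoef i k ^+ 2.
  by rewrite -(big_ord_widen m (fun k => pcoef i k ^+ 2) (ltnW Km)).
rewrite !widen {widen}.
case: K Km => [|K] Km; first by rewrite !big_ord0.
have n2 k : pnorm k ^+ 2 = (k != 0)%N.+1%:R / m%:R.
  by rewrite sqr_sqrtr// divr_ge0.
have m0 : 0 < m%:R :> R by rewrite ltr0n.
pose S i := \sum_(k < K) cos (k.+1%:R * (2 * ((2 * i + 1)%:R * path_angle))).
have sumE i : \sum_(k < K.+1) pcoef i k ^+ 2 = (1 + K%:R + S i) / m%:R.
  rewrite big_ord_recl /= -addrA mulrDl; congr (_ + _).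
    rewrite /pcoef /pcos !exprMn s2 n2 mul1r mul0r mulr0 cos0 expr1n mulr1.
    by rewrite div1r.
  have -> : K%:R = \sum_(k < K) 1 :> R by rewrite sumr_const card_ord.
  rewrite /S -big_split mulr_suml; apply: eq_bigr => k _ /=.
  rewrite /bump leq0n add1n /pcoef !exprMn s2 n2 mul1r /= /pcos.
  have -> : k.+1%:R * (2 * ((2 * i + 1)%:R * path_angle)) =
      ((2 * i + 1)%:R * (k.+1%:R * path_angle)) *+ 2.
    by rewrite mulr2n; ring.
  rewrite cos_mulr2n; move: (cos _) (m%:R) m0 => c mm mm0.
  by rewrite !mulr2n; field; rewrite gt_eqF.
rewrite !sumE ler_pM2r ?invr_gt0// lerD2l.
have sin_gt0 i : (i < m)%N -> 0 < sin ((2 * i + 1)%:R * path_angle).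
  move=> im; apply: sin_gt0_pi; rewrite mulr_gt0 ?ltr0n ?addn1//=.
  by rewrite -mangle ltr_pM2r// ltr_nat; lia.
have j0 := sin_gt0 j jm; have := sin_gt0 0%N isT.
move=> th0; rewrite -(ler_pM2l (mulr_gt0 j0 th0)).
have Dj := sin_dirichlet ((2 * j + 1)%:R * path_angle) K.
have D0 := sin_dirichlet ((2 * 0 + 1)%:R * path_angle) K.
rewrite -!/(S _) in Dj D0.
have odd_r r : odd (2 * r + 1) by rewrite addn1 /= mul2n odd_double.
have lt_r r : (r < m)%N -> (2 * r + 1 < 2 * m)%N by lia.
have := sin_product R (ltn0Sn (size p)) (odd_r j) (odd_r K) (lt_r j jm)
  (lt_r K (ltnW Km)).
rewrite -/path_angle mulnC natrM -mulrA -Dj.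
move: D0; rewrite muln0 add0n mul1r => <-.
by lra.
Qed.

Lemma eigpow_sum_path_root (alpha : R) (H0 : 'M[R]_n) (g : 'cV[R]_n) (h : R)
    (j : nat) :
  1 <= alpha -> H0^T = H0 -> bordered_ge0 H0 g h ->
  (forall i, (i < m)%N -> H0 *m pvec i = 0) ->
  (forall i, (i < m)%N -> dot g (pvec i) = 0) -> (j < m)%N ->
  eigpow_sum alpha (glued (pathmx x p) H0 g h (pvec 0)) <=
  eigpow_sum alpha (glued (pathmx x p) H0 g h (pvec j)).
Proof.
move=> alpha1 H0_sym H_ge0 H0p gp jm.
pose phi (k : 'I_m) := pmode k; pose lam (k : 'I_m) := peig k.
have H0phi k : H0 *m phi k = 0.
  by rewrite mulmx_sumr big1 // => i _; rewrite -scalemxAr H0p// scaler0.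
have gphi k : dot g (phi k) = 0.
  by rewrite dot_sumr big1 // => i _; rewrite dotZr gp// mulr0.
have Bphi (k : 'I_m) : pathmx x p *m phi k = lam k *: phi k by exact: pmode_eigen.
have lam_lt (k l : 'I_m) : (k < l)%N -> lam k < lam l.
  by move=> kl; exact: peig_lt.
have Bpsd := pathmx_psd x p.
have flip := eigpow_sum_norm alpha h Bpsd H0_sym dot_pmode Bphi H0phi gphi.
have -> : pvec 0 = combo phi (pcoef 0) := pvec_combo ord0.
have -> : pvec j = combo phi (pcoef j) := pvec_combo (Ordinal jm).
rewrite flip [leRHS]flip.
have norm2 i : (fun k : 'I_m => `|pcoef i k| ^+ 2) =1 (fun k => pcoef i k ^+ 2).
  by move=> k; rewrite real_normK ?num_real.
have one i (im : (i < m)%N) : \sum_(k < m) pcoef i k ^+ 2 = 1.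
  have := pcoef_rows (Ordinal im) (Ordinal im); rewrite eqxx mulr1n => <-.
  by apply: eq_bigr => k _; rewrite expr2.
apply: (eigpow_sum_transport alpha1 Bpsd H0_sym H_ge0 dot_pmode Bphi _ lam_lt) => //.
- by move=> k; exact: peig_ge0.
- by rewrite !(eq_bigr _ (fun k _ => norm2 _ k)) !one.
- move=> K; rewrite !(eq_bigr _ (fun k _ => norm2 _ k)).
  exact: pcoef_dominance.
Qed.

End PathSpectrum.
End PathMatrix.

(** * Making an inner vertex of a path an end *)

Section PathSequences.
Variables (R : realType) (n : nat) (sigma : R).
Hypothesis sigma2 : sigma ^+ 2 = 1.
Local Notation edge := (edgemx sigma).
Local Notation path := (pathmx sigma).
Local Notation e := (bvec R).
Implicit Types (x y z : 'I_n) (p q s : seq 'I_n).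

Definition pathseq (s : seq 'I_n) : 'M[R]_n :=
  if s is x :: p then path x p else 0.

Lemma pathmx_cat x p y q :
  path x (p ++ y :: q) = path x p + edge (last x p) y + path y q.
Proof.
elim: p x => [|z p IH] x /=; first by rewrite add0r.
by rewrite IH !addrA.
Qed.

Lemma last_rev_cons z x p : last z (rev (x :: p)) = x.
Proof. by rewrite rev_cons last_rcons. Qed.

Lemma pathseq_rev s : pathseq (rev s) = pathseq s.
Proof.
case: s => [//|x p]; elim: p x => [//|y p IH] x.
rewrite [RHS]/= -[pathmx sigma y p]/(pathseq (y :: p)) -IH.
rewrite rev_cons -cats1.
have lastE z r : rev (y :: p) = z :: r -> last z r = y.
  by move=> E; have := last_rev_cons z y p; rewrite E /=.
case E: (rev (y :: p)) lastE => [|z r] lastE.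
  by have := size_rev (y :: p); rewrite E.
rewrite /= pathmx_cat /= addr0 (lastE z r)// addrC; congr (_ + _).
exact: edgemxC.
Qed.

Lemma pathseq_join x p y q :
  pathseq (rev (x :: p) ++ y :: q) = path x p + edge x y + path y q.
Proof.
have E0 := pathseq_rev (x :: p); have L := last_rev_cons x x p.
case E: (rev (x :: p)) E0 L => [|z r] /= E0 L.
  by have := size_rev (x :: p); rewrite E.
by rewrite pathmx_cat E0 L.
Qed.

Lemma psdmxD (A B : 'M[R]_n) : psdmx A -> psdmx B -> psdmx (A + B).
Proof.
move=> [At A0] [Bt B0]; split=> [|z]; first by rewrite linearD /= At Bt.
by rewrite mulmxDl dotDr addr_ge0.
Qed.

Definition relabel (t : 'S_n) : 'M[R]_n := (perm_mx t)^T.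

Lemma relabel_bvec t x : relabel t *m e x = e (t x).
Proof.
apply/matrixP => i j; rewrite ord1 !mxE (bigD1 x)//= !mxE !eqxx mulr1.
rewrite big1 ?addr0 => [|k kx]; last by rewrite !mxE (negPf kx) mulr0.
by rewrite ?andbT eq_sym.
Qed.

Lemma relabel_orthogonal t : relabel t *m (relabel t)^T = 1%:M.
Proof.
by rewrite /relabel trmxK tr_perm_mx -perm_mxM mulVg perm_mx1.
Qed.

Lemma relabel_path (t : 'S_n) x p :
  path (t x) (map t p) = relabel t *m path x p *m (relabel t)^T.
Proof.
elim: p x => [|y p IH] x /=; first by rewrite mulmx0 mul0mx.
rewrite IH mulmxDr mulmxDl; congr (_ + _).
rewrite /edgemx -!relabel_bvec scalemxAr -mulmxBr trmx_mul !mulmxA.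
by [].
Qed.

(** The new path exchanges [r] with the first vertex of [s]. Up to that
transposition this moves [H] along a fixed path, from the position of [r] to the
end; [H] is written as a bordered matrix whose last coordinate is [r]. *)
Lemma eigpow_sum_merge (alpha : R) (H : 'M[R]_n) r s :
  1 <= alpha -> psdmx H -> uniq s -> r \in s ->
  (forall y, y \in s -> y != r -> H *m e y = 0) ->
  exists2 p, perm_eq (r :: p) s &
    eigpow_sum alpha (H + path r p) <= eigpow_sum alpha (H + pathseq s).
Proof.
case: s => [//|x q] alpha1 [Hsym Hpos] s_uniq rs H_supp.
pose t := tperm r x; have tx : t x = r by rewrite tpermR.
have t_mem y : y \in x :: q -> t y \in x :: q.
  by move=> ys; rewrite /t; case: tpermP => // _; rewrite mem_head.
exists (map t q).
  rewrite -tx -map_cons; apply: uniq_perm => //.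
    by rewrite map_inj_uniq//; exact: perm_inj.
  move=> y; apply/mapP/idP => [[z zs ->]|ys]; first exact: t_mem.
  by exists (t y); [exact: t_mem | rewrite /t tpermK].
pose h := dot (e r) (H *m e r).
have [g gE] : exists g : 'cV[R]_n, g = H *m e r - h *: e r by eexists.
pose H0 := H - g *m (e r)^T - e r *m g^T - h *: (e r *m (e r)^T).
have H_attach : H = attach H0 g h (e r).
  rewrite /attach /H0; move: (g *m _) (_ *m g^T) (h *: _) => X Y Z.
  by apply/matrixP => i j; rewrite !mxE; ring.
have H0_sym : H0^T = H0.
  rewrite /H0; move: (h) (e r) => c w; apply/matrixP => i k.
  have /matrixP/(_ i k) := Hsym; rewrite !mxE !big_ord1 !mxE => ->; ring.
have err : dot (e r) (e r) = 1 by rewrite dot_bvec2 eqxx.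
have gr : dot g (e r) = 0.
  by rewrite gE dotBl dotZl err dotC -/h mulr1 subrr.
have H0E (z : 'cV[R]_n) : H0 *m z = H *m z - dot (e r) z *: g - dot g z *: e r
     - (h * dot (e r) z) *: e r.
  by rewrite /H0 !mulmxBl -scalemxAl !mul_outer scalerA.
have g_supp y : y \in x :: q -> dot g (e y) = 0.
  move=> ys; have [->//|yr] := eqVneq y r.
  rewrite gE dotBl dotZl dot_mulmxl Hsym H_supp// dot0r dot_bvec2 eq_sym.
  by rewrite (negPf yr) mulr0 subrr.
have H0_supp y : y \in x :: q -> H0 *m e y = 0.
  move=> ys; rewrite H0E (g_supp y ys) scale0r subr0.
  have [->|yr] := eqVneq y r.
    rewrite err mulr1 scale1r gE.
    by apply/matrixP => i j; rewrite !mxE; ring.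
  by rewrite H_supp// dot_bvec2 eq_sym (negPf yr) mulr0 !scale0r !subr0.
have H_ge0 (z : 'cV[R]_n) c : 0 <= dot z (H0 *m z) + 2 * c * dot g z + h * c ^+ 2.
  (* [w] is [z] with its coordinate at [r] replaced by [c]. *)
  pose w := z + (c - dot (e r) z) *: e r.
  have wr : dot (e r) w = c by rewrite /w dotDr dotZr err; ring.
  have gw : dot g w = dot g z by rewrite /w dotDr dotZr gr mulr0 addr0.
  have H0w : H0 *m w = H0 *m z.
    by rewrite /w mulmxDr -scalemxAr H0_supp// scaler0 addr0.
  have wH0z : dot w (H0 *m z) = dot z (H0 *m z).
    by rewrite -H0_sym -!dot_mulmxl H0w.
  have := Hpos w; rewrite H_attach attach_mulE H0w wr gw !dotDr !dotZr wH0z.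
  rewrite (dotC w g) (dotC w (e r)) gw wr => le_q; apply: le_trans le_q _.
  by rewrite le_eqVlt; apply/orP; left; apply/eqP; ring.
have [j jm rE] : exists2 j, (j < (size q).+1)%N & pvec R x q j = e r.
  by exists (index r (x :: q)); [rewrite index_mem | rewrite /pvec nth_index].
have pvec_mem i : (i < (size q).+1)%N -> exists2 y, y \in x :: q & pvec R x q i = e y.
  by move=> iq; exists (nth x (x :: q) i) => //; rewrite mem_nth.
have := @eigpow_sum_path_root R n sigma sigma2 x q s_uniq alpha H0 g h j alpha1
  H0_sym H_ge0 _ _ jm.
have H0p i : (i < (size q).+1)%N -> H0 *m pvec R x q i = 0.
  by move=> /pvec_mem[y ys ->]; exact: H0_supp.
have gp i : (i < (size q).+1)%N -> dot g (pvec R x q i) = 0.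
  by move=> /pvec_mem[y ys ->]; exact: g_supp.
have glE : glued (path x q) H0 g h (e r) = H + path x q.
  by rewrite /glued -H_attach addrC.
move=> le_F; have {le_F} := le_F H0p gp; rewrite rE glE => le_F.
apply: le_trans le_F.
pose T := relabel t.
have Tt : T^T = T by rewrite /T /relabel trmxK tr_perm_mx /t tpermV.
have TT : T *m T = 1%:M by rewrite -{2}Tt relabel_orthogonal.
have TE (z : 'cV[R]_n) : T *m z = z + (z x 0 - z r 0) *: (e r - e x).
  apply/matrixP => i k; rewrite ord1 /T /relabel /t tr_perm_mx tpermV -row_permE.
  rewrite !mxE !eqxx !andbT; have [->|ir] := eqVneq i r.
    by rewrite tpermL; have [->|_] := eqVneq r x; rewrite /=; ring.
  have [->|ix] := eqVneq i x; first by rewrite tpermR /=; ring.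
  by rewrite tpermD 1?eq_sym//=; ring.
have xs := mem_head x q.
have H0T : H0 *m T = H0.
  apply: eq_mulmx_cV => z; rewrite -mulmxA TE mulmxDr -scalemxAr mulmxBr.
  by rewrite !H0_supp// subrr scaler0 addr0.
have Tg : T^T *m g = g.
  by rewrite Tt TE -!(dot_bvec _ g) !(dotC _ g) !g_supp// subrr scale0r addr0.
have Tx : T *m e x = e r by rewrite relabel_bvec tx.
have := @attach_conj R n H0 g h H0_sym T (e x).
rewrite {1}Tt Tx -H_attach => /(_ TT H0T Tg); rewrite Tt => THT.
rewrite -(eigpow_sum_similar alpha (H + path r _) TT).
rewrite mulmxDr mulmxDl THT -tx relabel_path -/T Tt !mulmxA TT mul1mx.
by rewrite -mulmxA TT mulmx1 addrC.
Qed.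

End PathSequences.

(** * Rooted trees and their straightening *)

Section Trees.
Variable n : nat.

(** [Join t1 t2] hangs the root of [t2] below the root of [t1], which stays the
root: every rooted tree arises by adding one child at a time, and induction on
this binary shape always leaves two smaller rooted trees. *)
Inductive rtree := Leaf of 'I_n | Join of rtree & rtree.

Fixpoint troot t := match t with Leaf x => x | Join t1 _ => troot t1 end.

Fixpoint verts t : seq 'I_n :=
  match t with Leaf x => [:: x] | Join t1 t2 => verts t1 ++ verts t2 end.

Fixpoint subtree_of (G : rel 'I_n) t : bool :=
  match t with
  | Leaf _ => true
  | Join t1 t2 => [&& G (troot t1) (troot t2), subtree_of G t1 & subtree_of G t2]
  end.

Fixpoint graft t (x y : 'I_n) : rtree :=
  match t with
  | Leaf z => Join (Leaf z) (Leaf y)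
  | Join t1 t2 =>
      if x \in verts t1 then Join (graft t1 x y) t2 else Join t1 (graft t2 x y)
  end.

Lemma troot_in t : troot t \in verts t.
Proof. by elim: t => [x|t1 IH1 t2 _] /=; rewrite ?mem_seq1// mem_cat IH1. Qed.

Lemma troot_graft t x y : troot (graft t x y) = troot t.
Proof. by elim: t => [z|t1 IH1 t2 _] //=; case: ifP. Qed.

Lemma verts_graft t x y : x \in verts t ->
  perm_eq (verts (graft t x y)) (y :: verts t).
Proof.
elim: t => [z|t1 IH1 t2 IH2] /=.
  by move=> _; rewrite -[[:: z; y]]/([:: z] ++ [:: y]) perm_catC.
rewrite mem_cat; case: ifP => [x1 _|x1 /= x2] /=.
  by rewrite -cat_cons perm_cat2r IH1.
apply: (perm_trans (y := verts t1 ++ y :: verts t2)).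
  by rewrite perm_cat2l IH2.
by rewrite perm_catC /= perm_cons perm_catC.
Qed.

Lemma subtree_graft (G : rel 'I_n) t x y : x \in verts t -> G x y ->
  subtree_of G t -> subtree_of G (graft t x y).
Proof.
elim: t => [z|t1 IH1 t2 IH2] /=.
  by rewrite mem_seq1 => /eqP -> ->.
rewrite mem_cat => x12 Gxy /and3P[G12 G1 G2]; case: ifP x12 => [x1 _|x1 x2] /=.
  by rewrite troot_graft G12 IH1.
by rewrite troot_graft G12 G1 IH2.
Qed.

Lemma connect_exit (G : rel 'I_n) (s : seq 'I_n) (x y : 'I_n) :
  connect G x y -> x \in s -> y \notin s ->
  exists u v, [/\ u \in s, v \notin s & G u v].
Proof.
move=> /connectP[p Gp ->]; elim: p x Gp => [|z p IH] x /=.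
  by move=> _ ->.
move=> /andP[Gxz Gp] xs; have [zs|zs] := boolP (z \in s); first exact: IH.
by exists x, z.
Qed.

(** A tree that misses a vertex can be extended along an edge leaving it. *)
Lemma spanning_tree (G : sgraph n) : connected_graph G ->
  exists t, [/\ uniq (verts t), forall x, x \in verts t & subtree_of G t].
Proof.
move=> [n_gt0 Gconn].
have grow k : (0 < k <= n)%N ->
    exists t, [/\ uniq (verts t), size (verts t) = k & subtree_of G t].
  elim: k => [//|[|k] IH] kn; first by exists (Leaf (Ordinal n_gt0)).
  have [|t [t_uniq t_size tG]] := IH; first by case/andP: kn => _ /ltnW.
  have [y yt] : exists y, y \notin verts t.
    apply/existsP; rewrite -negb_forall; apply: contraTN kn => /forallP all_t.
    rewrite -t_size -leqNgt /= -{1}(card_ord n) -(card_uniqP t_uniq).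
    by rewrite [#|verts t|](eq_card (B := 'I_n)).
  have [u [v [ut vt Guv]]] := connect_exit (Gconn (troot t) y) (troot_in t) yt.
  exists (graft t u v); have vperm := verts_graft v ut; split.
  - by rewrite (perm_uniq vperm) /= vt.
  - by rewrite (perm_size vperm) /= t_size.
  - exact: subtree_graft.
have [|t [t_uniq t_size tG]] := grow n; first by rewrite n_gt0 leqnn.
exists t; split=> // x; have := uniq_min_size t_uniq (s2 := enum 'I_n).
rewrite size_enum_ord t_size => /(_ (fun y _ => mem_enum _ y) (leqnn n))[_ ->].
exact: mem_enum.
Qed.

Section TreeMatrix.
Variables (R : realType) (sigma : R).
Hypothesis sigma2 : sigma ^+ 2 = 1.
Local Notation edge := (edgemx sigma).

Fixpoint treemx t : 'M[R]_n :=
  if t is Join t1 t2 then treemx t1 + treemx t2 + edge (troot t1) (troot t2) else 0.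

Lemma treemx_psd t : psdmx (treemx t).
Proof.
elim: t => [x|t1 IH1 t2 IH2] /=.
  by split=> [|z]; rewrite ?trmx0// mul0mx dot0r.
by apply: psdmxD; [apply: psdmxD | exact: edgemx_psd].
Qed.

Lemma treemx_supp t z : z \notin verts t -> treemx t *m bvec R z = 0.
Proof.
elim: t => [x|t1 IH1 t2 IH2] /=; first by rewrite mul0mx.
rewrite mem_cat negb_or => /andP[z1 z2].
rewrite !mulmxDl IH1// IH2// edgemx_supp ?addr0//.
  by apply: contraNneq z1 => ->; exact: troot_in.
by apply: contraNneq z2 => ->; exact: troot_in.
Qed.

(** The two branches of a join are straightened one after the other, each with
everything else as the attached part. The two resulting paths and the edge
between their ends form one path with the root inside, and the root is moved to
its end. The matrix [H] is arbitrary so that it can absorb everything else. *)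
Lemma eigpow_sum_straighten (alpha : R) (H : 'M[R]_n) t :
  1 <= alpha -> psdmx H -> uniq (verts t) ->
  (forall y, y \in verts t -> y != troot t -> H *m bvec R y = 0) ->
  exists2 p, perm_eq (troot t :: p) (verts t) &
    eigpow_sum alpha (H + pathmx sigma (troot t) p) <=
    eigpow_sum alpha (H + treemx t).
Proof.
move=> alpha1; elim: t H => [x|t1 IH1 t2 IH2] H Hpsd /=.
  by move=> _ _; exists [::].
rewrite cat_uniq => /and3P[u1 /hasPn disj u2] H_supp.
set r1 := troot t1; set r2 := troot t2.
have r1_in : r1 \in verts t1 := troot_in t1.
have r2_in : r2 \in verts t2 := troot_in t2.
have e_psd : psdmx (edge r1 r2) := edgemx_psd _ _ _.
have [||p2 perm2 le2] := IH2 (H + treemx t1 + edge r1 r2) _ u2.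
- by apply: psdmxD => //; apply: psdmxD => //; exact: treemx_psd.
- move=> y y2 yr2; have y1 := disj y y2; have yr1 : y != r1.
    by apply: contraNneq y1 => ->.
  rewrite !mulmxDl H_supp ?mem_cat ?y2 ?orbT// treemx_supp//.
  by rewrite edgemx_supp// !addr0.
have [||p1 perm1 le1] := IH1 (H + edge r1 r2 + pathmx sigma r2 p2) _ u1.
- by apply: psdmxD; [exact: psdmxD | exact: pathmx_psd].
- move=> y y1 yr1; have y2 : y \notin verts t2.
    by apply/negP => /disj; rewrite y1.
  rewrite !mulmxDl H_supp ?mem_cat ?y1//.
  rewrite pathmx_supp ?(perm_mem perm2)// edgemx_supp ?addr0//.
  by apply: contraNneq y2 => ->.
have permj : perm_eq (rev (r1 :: p1) ++ r2 :: p2) (verts t1 ++ verts t2).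
  by apply: perm_cat perm2; rewrite perm_rev.
have [|||p permp lep] := eigpow_sum_merge (r := r1)
  (s := rev (r1 :: p1) ++ r2 :: p2) sigma2 alpha1 Hpsd.
- rewrite (perm_uniq permj) cat_uniq u1 u2 andbT /=; exact/hasPn.
- by rewrite (perm_mem permj) mem_cat r1_in.
- by move=> y; rewrite (perm_mem permj); exact: H_supp.
exists p; first exact: perm_trans permj.
apply: (le_trans lep); rewrite (pathseq_join sigma2).
have -> : H + (pathmx sigma r1 p1 + edge r1 r2 + pathmx sigma r2 p2) =
   H + edge r1 r2 + pathmx sigma r2 p2 + pathmx sigma r1 p1.
  by rewrite [pathmx sigma r1 p1 + _]addrC -addrA [pathmx _ r1 p1 + _]addrC !addrA.
apply: (le_trans le1).
have -> : H + edge r1 r2 + pathmx sigma r2 p2 + treemx t1 =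
   H + treemx t1 + edge r1 r2 + pathmx sigma r2 p2.
  by rewrite addrAC; congr (_ + _); rewrite addrAC.
apply: (le_trans le2).
have -> : H + treemx t1 + edge r1 r2 + treemx t2 =
  H + (treemx t1 + treemx t2 + edge r1 r2).
  by rewrite addrAC !addrA.
exact: lexx.
Qed.

End TreeMatrix.
End Trees.

(** * Laplacian and signless Laplacian *)

Section GraphMatrices.
Variables (R : realType) (n : nat) (sigma : R).
Hypothesis sigma2 : sigma ^+ 2 = 1.
Implicit Type G : sgraph n.

Definition signed_laplacian G : 'M[R]_n :=
  degree_mx R G - sigma *: adjacency_mx R G.

Let q (z : 'cV[R]_n) (x y : 'I_n) : R := (z x 0 - sigma * z y 0) ^+ 2.

Let q_ge0 z x y : 0 <= q z x y. Proof. exact: sqr_ge0. Qed.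

Let qC z x y : q z x y = q z y x.
Proof. by rewrite /q; ring: sigma2. Qed.

Lemma degreeE G x : (degree G x)%:R = \sum_y (G x y)%:R :> R.
Proof.
rewrite /degree -sum1_card natr_sum big_mkcond; apply: eq_bigr => y _.
by rewrite inE; case: (G x y).
Qed.

Lemma signed_laplacian_quad G z : dot z (signed_laplacian G *m z) =
  2^-1 * \sum_x \sum_y (G x y)%:R * q z x y.
Proof.
pose S := \sum_x \sum_y (G x y)%:R * z x 0 ^+ 2.
pose P := \sum_x \sum_y (G x y)%:R * (z x 0 * z y 0).
have S' : \sum_x \sum_y (G x y)%:R * z y 0 ^+ 2 = S.
  rewrite exchange_big; apply: eq_bigr => x _; apply: eq_bigr => y _.
  by rewrite adj_sym.
have -> : \sum_x \sum_y (G x y)%:R * q z x y = 2 * S - 2 * sigma * P.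
  transitivity (S - 2 * sigma * P + \sum_x \sum_y (G x y)%:R * z y 0 ^+ 2).
    rewrite mulr_sumr -sumrB -big_split; apply: eq_bigr => x _ /=.
    rewrite mulr_sumr -sumrB -big_split; apply: eq_bigr => y _ /=.
    by rewrite /q; ring: sigma2.
  by rewrite S'; ring.
have -> : 2^-1 * (2 * S - 2 * sigma * P) = S - sigma * P by field.
rewrite mulmxBl dotBr -scalemxAl dotZr; congr (_ - _ * _).
  rewrite /degree_mx mul_diag_mx dotE; apply: eq_bigr => x _.
  rewrite !mxE degreeE -mulr_suml; ring.
rewrite dotE; apply: eq_bigr => x _; rewrite mxE mulr_sumr; apply: eq_bigr => y _.
by rewrite mxE; ring.
Qed.

Lemma signed_laplacian_psd G : psdmx (signed_laplacian G).
Proof.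
split=> [|z]; last first.
  rewrite signed_laplacian_quad mulr_ge0 ?invr_ge0 ?ler0n// sumr_ge0// => x _.
  by apply: sumr_ge0 => y _; rewrite mulr_ge0.
apply/matrixP => x y; rewrite !mxE adj_sym eq_sym.
by case: eqVneq => [->|]; rewrite ?mulr0n.
Qed.

Let qsum (G : rel 'I_n) z (s1 s2 : seq 'I_n) : R :=
  \sum_(x <- s1) \sum_(y <- s2) (G x y)%:R * q z x y.

Let qsum_ge_edge (G : rel 'I_n) z s1 s2 x y : x \in s1 -> y \in s2 -> G x y ->
  q z x y <= qsum G z s1 s2.
Proof.
move=> xs ys Gxy.
rewrite /qsum (big_rem x)//= (big_rem y)//= Gxy mul1r -addrA lerDl.
rewrite addr_ge0//; first by apply: sumr_ge0 => y' _; rewrite mulr_ge0.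
by apply: sumr_ge0 => x' _; apply: sumr_ge0 => y' _; rewrite mulr_ge0.
Qed.

(** In the double sum over ordered pairs of vertices each edge counts twice; the
edge joining two branches appears in both cross sums. *)
Lemma subtree_quad_le (G : rel 'I_n) (t : rtree n) z : symmetric G -> subtree_of G t ->
  dot z (treemx sigma t *m z) <= 2^-1 * qsum G z (verts t) (verts t).
Proof.
move=> Gsym; elim: t => [x|t1 IH1 t2 IH2] /=.
  move=> _; rewrite mul0mx dot0r mulr_ge0 ?invr_ge0 ?ler0n// sumr_ge0// => x' _.
  by apply: sumr_ge0 => y' _; rewrite mulr_ge0.
move=> /and3P[G12 /IH1 le1 /IH2 le2].
rewrite !mulmxDl !dotDr edgemx_quad -/(q z _ _).
have G21 : G (troot t2) (troot t1) by rewrite Gsym.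
have e12 := qsum_ge_edge z (troot_in t1) (troot_in t2) G12.
have := qsum_ge_edge z (troot_in t2) (troot_in t1) G21; rewrite qC => e21.
have -> : qsum G z (verts t1 ++ verts t2) (verts t1 ++ verts t2) =
   qsum G z (verts t1) (verts t1) + qsum G z (verts t1) (verts t2)
   + (qsum G z (verts t2) (verts t1) + qsum G z (verts t2) (verts t2)).
  rewrite /qsum big_cat /= -!big_split.
  by congr (_ + _); apply: eq_bigr => x _; rewrite big_cat.
by lra.
Qed.

End GraphMatrices.

Section PathGraph.
Variables (R : realType) (sigma : R).
Hypothesis sigma2 : sigma ^+ 2 = 1.

Lemma sum_successors N (f : 'I_N.+1 -> 'I_N.+1 -> R) :
  \sum_(x < N.+1) \sum_(y < N.+1) (x.+1 == y :> nat)%:R * f x y =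
  \sum_(i < N) f (inord i) (inord i.+1).
Proof.
rewrite big_ord_recr /= [X in _ + X]big1 ?addr0; last first.
  by move=> y _; rewrite gtn_eqF ?ltn_ord// mul0r.
apply: eq_bigr => i _; rewrite (bigD1 (inord i.+1))//= inordK ?ltnS//.
rewrite eqxx mul1r big1 ?addr0.
  by congr (f _ _); apply: val_inj; rewrite /= inordK// ltnS ltnW.
move=> y; rewrite -val_eqE /= inordK ?ltnS// eq_sym => /negPf ->.
by rewrite mul0r.
Qed.

Lemma signed_laplacian_path_quad_le n (z : 'cV[R]_n) :
  dot z (signed_laplacian sigma (path_graph n) *m z) <=
  dot z (pathseq sigma (enum 'I_n) *m z).
Proof.
rewrite (signed_laplacian_quad sigma2).
case: n z => [|N] z; first by rewrite big_ord0 mulr0 enum_ord0 mul0mx dot0r.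
pose q (x y : 'I_N.+1) := (z x 0 - sigma * z y 0) ^+ 2.
have qC x y : q x y = q y x by rewrite /q; ring: sigma2.
have q_ge0 x y : 0 <= q x y := sqr_ge0 _.
have -> : dot z (pathseq sigma (enum 'I_N.+1) *m z) =
    \sum_(i < N) q (inord i) (inord i.+1).
  have szE : size (enum 'I_N.+1) = N.+1 by rewrite size_enum_ord.
  have nthE (i : nat) : (i < N.+1)%N -> nth ord0 (enum 'I_N.+1) i = inord i.
    by move=> iN; apply: val_inj; rewrite /= nth_enum_ord// inordK.
  case: (enum _) szE nthE => [//|x p] /= [szp] nthE.
  rewrite (pathmx_nth _ ord0) szp mulmx_suml dot_sumr; apply: eq_bigr => i _.
  by rewrite edgemx_quad !nthE// ltnS// ltnW.
rewrite -sum_successors; set S := (X in _ <= X).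
apply: le_trans (_ : 2^-1 * (S + S) <= _); last by lra.
rewrite ler_pM2l ?invr_gt0// {2}/S [X in S + X]exchange_big -big_split.
apply: ler_sum => x _ /=; rewrite -big_split; apply: ler_sum => y _ /=.
rewrite -/(q x y) (qC y x) -mulrDl ler_wpM2r// /path_rel.
by rewrite -natrD ler_nat; case: (_ == _) (_ == _) => -[].
Qed.

Lemma enum_relabel n (s : seq 'I_n) : perm_eq s (enum 'I_n) ->
  exists t : 'S_n, s = map t (enum 'I_n).
Proof.
move=> s_perm; have s_uniq : uniq s by rewrite (perm_uniq s_perm) enum_uniq.
have s_size : size s = n by rewrite (perm_size s_perm) size_enum_ord.
pose f (i : 'I_n) := nth i s i.
have fE (i j : 'I_n) : nth j s i = f i by apply: set_nth_default; rewrite s_size.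
have f_inj : injective f.
  move=> i j; rewrite -(fE i i) -(fE j i) => /eqP.
  by rewrite nth_uniq ?s_size// => /eqP/val_inj.
exists (perm f_inj); case: n s s_perm s_uniq s_size f fE f_inj => [|N] s.
  by move=> _ _ /size0nil -> f _ f_inj; rewrite enum_ord0.
move=> _ _ s_size f fE f_inj; apply: (@eq_from_nth _ ord0).
  by rewrite size_map size_enum_ord.
move=> i; rewrite s_size => iN.
rewrite (nth_map ord0) ?size_enum_ord// permE -(fE _ ord0).
by rewrite nth_enum_ord.
Qed.

Lemma eigpow_sum_spanning_path alpha n (G : sgraph n) :
  1 <= alpha -> connected_graph G ->
  eigpow_sum alpha (signed_laplacian sigma (path_graph n)) <=
  eigpow_sum alpha (signed_laplacian sigma G).
Proof.
move=> alpha1 Gconn; have [t [t_uniq t_all tG]] := spanning_tree Gconn.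
have psd0 : psdmx (0 : 'M[R]_n).
  by split=> [|z]; rewrite ?trmx0// mul0mx dot0r.
have [|p p_perm] := eigpow_sum_straighten sigma2 alpha1 psd0 t_uniq.
  by move=> y _ _; rewrite mul0mx.
rewrite !add0r => le_t.
have v_perm : perm_eq (verts t) (enum 'I_n).
  by apply: uniq_perm; rewrite ?enum_uniq// => x; rewrite t_all mem_enum.
have Gpsd (H : sgraph n) := signed_laplacian_psd sigma2 H.
apply: (le_trans (y := eigpow_sum alpha (treemx sigma t))); last first.
  apply: (eigpow_sum_monotone alpha1 (treemx_psd sigma t) (Gpsd G)) => z.
  apply: le_trans (subtree_quad_le sigma2 z (@adj_sym _ G) tG) _.
  rewrite (signed_laplacian_quad sigma2) (perm_big _ v_perm) big_enum /=.
  rewrite le_eqVlt; apply/orP; left; apply/eqP; congr (_ * _).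
  by apply: eq_bigr => x _; rewrite (perm_big _ v_perm) big_enum.
apply: (le_trans _ le_t).
have [tau tauE] := enum_relabel (perm_trans p_perm v_perm).
have pathE : pathmx sigma (troot t) p =
    relabel R tau *m pathseq sigma (enum 'I_n) *m (relabel R tau)^T.
  by case: (enum 'I_n) tauE => // x s [-> ->]; rewrite relabel_path.
rewrite pathE (eigpow_sum_similar _ _ (relabel_orthogonal R tau)).
apply: (eigpow_sum_monotone alpha1 (Gpsd _)); last first.
  exact: signed_laplacian_path_quad_le.
by case: (enum 'I_n) => [|x s]; [exact: psd0 | exact: pathmx_psd].
Qed.

End PathGraph.

Theorem corollary3p8 (R : realType) (n : nat) (G : sgraph n)
    (G_connected : connected_graph G) (alpha : R) (alpha_ge1 : 1 <= alpha) :
  \sum_(i < n) eigval (laplacian R G) i `^ alpha >=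
    \sum_(i < n) eigval (laplacian R (path_graph n)) i `^ alpha
  /\
  \sum_(i < n) eigval (signless_laplacian R G) i `^ alpha >=
    \sum_(i < n) eigval (signless_laplacian R (path_graph n)) i `^ alpha.
Proof.
have lapE (H : sgraph n) : laplacian R H = signed_laplacian 1 H.
  by rewrite /signed_laplacian scale1r.
have slapE (H : sgraph n) : signless_laplacian R H = signed_laplacian (-1) H.
  by rewrite /signed_laplacian scaleN1r opprK.
split; rewrite ?lapE ?slapE.
  exact: (eigpow_sum_spanning_path (expr1n _ 2) alpha_ge1 G_connected).
have sq : (-1) ^+ 2 = 1 :> R by rewrite sqrrN expr1n.
exact: (eigpow_sum_spanning_path sq alpha_ge1 G_connected).
Qed.
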